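(* Let $m,n\ge 3$ and let $C_m\vee_a C_n$ be the wedge of the cycle graphs $C_m$ and $C_n$ obtained by identifying a vertex of $C_m$ with a vertex of $C_n$ into a vertex $a$. Then the independence complex $\mathcal{I}(C_m\vee_a C_n)$ is either contractible or homotopy equivalent to a wedge of spheres.
   Context: The cycle graph $C_n$ has vertices $1,\dots,n$ with edges $\{i,i+1\}$ (indices mod $n$). The wedge $G_1\vee_a G_2$ of graphs at chosen vertices $a_1\in G_1$, $a_2\in G_2$ is obtained from the disjoint union by identifying $a_1$ and $a_2$ into a single vertex $a$ (edges incident to $a_i$ become incident to $a$). The independence complex $\mathcal{I}(G)$ is the simplicial complex whose simplices are the independent vertex sets of $G$. *)

(* Defs.v *)
From HB Require Import structures.
From mathcomp Require Import all_boot all_order all_algebra.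
From mathcomp Require Import all_classical all_reals all_analysis.
From mathcomp Require Import homotopy.

Set Implicit Arguments.
Unset Strict Implicit.
Unset Printing Implicit Defensive.

Import Order.TTheory GRing.Theory Num.Theory numFieldNormedType.Exports.

Local Open Scope classical_set_scope.
Local Open Scope ring_scope.

(* Graphs are given by their adjacency relation on a finite vertex type. *)

Definition cycle_adj (n : nat) : rel 'I_n :=
  [rel i j | (j == ordS i) || (i == ordS j)].
Arguments cycle_adj n : clear implicits.

Section GraphWedge.
Variables (V1 V2 : finType) (e1 : rel V1) (e2 : rel V2) (a1 : V1) (a2 : V2).

Definition disjoint_union_adj : rel (V1 + V2) := fun x y =>
  match x, y with
  | inl u, inl v => e1 u v
  | inr u, inr v => e2 u v
  | _, _ => false
  end.

(* The quotient of V1 + V2 identifying a1 with a2; inl a1 is the common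
   vertex a. *)
Definition graph_wedge_vertex : finType := (V1 + {v : V2 | v != a2})%type.

Definition graph_wedge_proj (x : V1 + V2) : graph_wedge_vertex :=
  match x with
  | inl u => inl u
  | inr v => if insub v is Some v' then inr v' else inl a1
  end.

Definition graph_wedge_adj : rel graph_wedge_vertex := fun p q =>
  [exists x, exists y, [&& graph_wedge_proj x == p, graph_wedge_proj y == q
                         & disjoint_union_adj x y]].

End GraphWedge.
Arguments graph_wedge_vertex V1 {V2} a2.
Arguments graph_wedge_proj {V1 V2} a1 a2 x.
Arguments graph_wedge_adj {V1 V2} e1 e2 a1 a2 p q.

Definition independence_complex (V : finType) (e : rel V) : {set {set V}} :=
  finset (fun S : {set V} => [forall x in S, forall y in S, ~~ e x y]).

(* Barycentric coordinates. As V is finite, the subspace of the product V -> R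
   carries the usual topology of the realization. *)
Definition realization_set (R : realType) (V : finType) (K : {set {set V}}) :
    set {ptws V -> R} :=
  [set x : {ptws V -> R} | [/\ forall v, 0 <= x v, \sum_v x v = 1
             & finset (fun v => x v != 0) \in K]].
Arguments realization_set R {V} K.

Definition realization (R : realType) (V : finType) (K : {set {set V}}) :
    topologicalType := set_type (realization_set R K).
Arguments realization R {V} K.

Definition homotopic (R : realType) (X Y : topologicalType) (f g : X -> Y) :=
  exists H : X * R -> Y,
    [/\ {within [set: X] `*` `[0, 1], continuous H},
        forall x, H (x, 0) = f x
      & forall x, H (x, 1) = g x].
Arguments homotopic R {X Y} f g.

Definition homotopy_equivalent (R : realType) (X Y : topologicalType) :=
  exists (f : X -> Y) (g : Y -> X),
    [/\ continuous f, continuous g,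
        homotopic R (g \o f) idfun & homotopic R (f \o g) idfun].
Arguments homotopy_equivalent R X Y : clear implicits.

Definition contractible (R : realType) (X : topologicalType) :=
  exists x0 : X, homotopic R (@idfun X) (cst x0).
Arguments contractible R X : clear implicits.

Definition sphere (R : realType) (d : nat) : set 'rV[R]_d.+1 :=
  [set x : 'rV[R]_d.+1 | \sum_i x 0 i ^+ 2 = 1].
Arguments sphere R d : clear implicits.

Lemma sphere_base_subproof (R : realType) (d : nat) :
  (delta_mx 0 0 : 'rV[R]_d.+1) \in sphere R d.
Proof.
rewrite inE /sphere /= (bigD1 ord0) //= mxE !eqxx expr1n big1 ?addr0 // => i i0.
by rewrite mxE (negPf i0) andbF expr0n.
Qed.

Definition sphere_base (R : realType) (d : nat) : sphere R d :=
  @exist _ (fun x => x \in sphere R d) (delta_mx 0 0) (sphere_base_subproof R d).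

Definition wedge_of_spheres (R : realType) (k : nat) (d : 'I_k -> nat) :
    topologicalType :=
  wedge (fun i : 'I_k => sphere_base R (d i)).
Arguments wedge_of_spheres R {k} d.

(* Main.v *)
Require Import Defs.
From mathcomp Require Import all_boot all_order all_algebra.
From mathcomp Require Import all_classical all_reals all_analysis.
From mathcomp Require Import homotopy.
From mathcomp Require Import ring lra zify.

(** Let the link of a simplex {u, v} (u = v allowed) be a cone with apex w.
    Pushing the mass min(x_u, x_v) from u and v to w is a straight-line
    deformation onto the complex without the open star of {u, v}. In an
    independence complex this adds the edge uv to the graph, and the condition
    is N(w) <= N(u) + N(v); a loop at u deletes the vertex u. With such moves
    every path of length 4 through vertices of degree 2 becomes an edge plus a
    disjoint K_2, so C_m v C_n reduces to two cycles of length 2, 3 or 4 sharing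
    a vertex, plus copies of K_2. Except for two triangles, further moves leave
    an isolated vertex or copies of K_2 only, i.e. a cone or the boundary of a
    cross-polytope. For two triangles the complex is an iterated suspension of
    the disjoint union of a circle and a point; duplicating each suspension pair
    turns it into two cross-polytope boundaries sharing one vertex. *)

Set Implicit Arguments.
Unset Strict Implicit.
Unset Printing Implicit Defensive.
Import Order.TTheory GRing.Theory Num.Theory numFieldNormedType.Exports.

(** * Homotopy *)

Section Homotopy.
Local Open Scope classical_set_scope.
Local Open Scope ring_scope.
Variable R : realType.
Implicit Types X Y Z : topologicalType.

(** Shortening a cycle by three edges is a suspension: a separate edge yz joins the complex with the
    two points y and z. The obstacle is that a suspension of a wedge is a wedge of suspensions only
    after the segment through the wedge point is collapsed. Hence the vertex set is doubled at the
    start and the second copy carries loops. As a looped vertex is absent from the complex, vertices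
    are deleted and revived over a fixed vertex type, and every step compares two edge lists.
    Cross-polytopes are the final models because their boundary is the unit sphere of the l1-norm,
    which gives an explicit homeomorphism with the round sphere. *)

Lemma continuous_o X Y Z (f : X -> Y) (g : Y -> Z) :
  continuous f -> continuous g -> continuous (g \o f).
Proof. by move=> cf cg x; apply: continuous_comp; [exact: cf|exact: cg]. Qed.

Lemma continuous_pair X Y Z (f : X -> Y) (g : X -> Z) :
  continuous f -> continuous g -> continuous (fun x => (f x, g x)).
Proof. by move=> cf cg x; apply: cvg_pair; [exact: cf|exact: cg]. Qed.

Lemma continuous_ptws X (V : choiceType) (f : X -> {ptws V -> R}) :
  (forall v, continuous (fun x => f x v)) -> continuous f.
Proof.
move=> cf x; apply/cvg_sup => v.
exact: (@continuous_comp_initial _ _ _ (fun g : V -> R => g v) f (cf v)).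
Qed.

Lemma continuous_coord (V : choiceType) (v : V) :
  continuous (fun x : {ptws V -> R} => x v).
Proof. exact: (@proj_continuous V (fun=> R) v). Qed.

Section RealValued.
Variables (X : topologicalType) (f g : X -> R).
Hypotheses (cf : continuous f) (cg : continuous g).

Lemma continuous_addr : continuous (fun x => f x + g x).
Proof. by move=> x; apply: cvgD; [exact: cf|exact: cg]. Qed.

Lemma continuous_oppr : continuous (fun x => - f x).
Proof. by move=> x; apply: cvgN; exact: cf. Qed.

Lemma continuous_subr : continuous (fun x => f x - g x).
Proof. by move=> x; apply: cvgB; [exact: cf|exact: cg]. Qed.

Lemma continuous_mulr : continuous (fun x => f x * g x).
Proof. by move=> x; apply: cvgM; [exact: cf|exact: cg]. Qed.

Lemma continuous_minr : continuous (fun x => Num.min (f x) (g x)).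
Proof. by move=> x; apply: continuous_min; [exact: cf|exact: cg]. Qed.

Lemma continuous_maxr : continuous (fun x => Num.max (f x) (g x)).
Proof. by move=> x; apply: continuous_max; [exact: cf|exact: cg]. Qed.

Lemma continuous_invr : (forall x, f x != 0) -> continuous (fun x => (f x)^-1).
Proof. by move=> f0 x; apply: cvgV; [exact: f0|exact: cf]. Qed.

End RealValued.

Lemma continuous_sumr (X : topologicalType) (I : Type) (r : seq I)
    (P : pred I) (F : I -> X -> R) :
  (forall i, continuous (F i)) -> continuous (fun x => \sum_(i <- r | P i) F i x).
Proof.
move=> cF; elim: r => [|i r IH].
  under eq_fun do rewrite big_nil; exact: cst_continuous.
under eq_fun do rewrite big_cons.
by case: (P i) => //; exact: continuous_addr.
Qed.

Definition clamp (t : R) : R := Num.max 0 (Num.min 1 t).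

Lemma clamp_continuous : continuous clamp.
Proof.
move=> t; apply: continuous_max; first exact: cst_continuous.
by apply: continuous_min; [exact: cst_continuous|exact: cvg_id].
Qed.

Lemma clamp_ge0 t : 0 <= clamp t.
Proof. by rewrite /clamp le_max lexx. Qed.

Lemma clamp_le1 t : clamp t <= 1.
Proof. by rewrite /clamp ge_max ler01 ge_min lexx. Qed.

Lemma clamp0 : clamp 0 = 0.
Proof. by rewrite /clamp min_r ?ler01 // maxxx. Qed.

Lemma clamp1 : clamp 1 = 1.
Proof. by rewrite /clamp minxx max_r ?ler01. Qed.

(** Precomposing time with the retraction [clamp] of the line onto [0, 1] makes a homotopy
    continuous for all times, so later arguments avoid the subspace topology. *)
Lemma homotopicP X Y (f g : X -> Y) :
  homotopic R f g <->
  exists H : X * R -> Y, [/\ continuous H, forall x, H (x, 0) = f x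
                           & forall x, H (x, 1) = g x].
Proof.
split=> -[H [cH H0 H1]]; [exists (fun p => H (p.1, clamp p.2))|exists H].
  split=> [|x|x]; rewrite /= ?clamp0 ?clamp1 //.
  move: cH => /subspace_sigL_continuousP cH.
  have mem (p : X * R) : (p.1, clamp p.2) \in [set: X] `*` `[(0:R), 1].
    by rewrite inE; split=> //=; rewrite in_itv /= clamp_ge0 clamp_le1.
  pose phi (p : X * R) : set_type ([set: X] `*` `[(0:R), 1]) :=
    @exist _ (fun q => q \in [set: X] `*` `[(0:R), 1]) _ (mem p).
  have cphi : continuous phi.
    apply: continuous_comp_initial.
    apply: continuous_pair; first by move=> p; exact: cvg_fst.
    move=> p; apply: continuous_comp; [exact: cvg_snd|exact: clamp_continuous].
  exact: (continuous_o cphi cH).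
by split=> //; exact: continuous_subspaceT.
Qed.

Lemma homotopic_refl X Y (f : X -> Y) : continuous f -> homotopic R f f.
Proof.
move=> cf; apply/homotopicP; exists (f \o fst); split=> // p.
by apply: continuous_comp; [exact: cvg_fst|exact: cf].
Qed.

Lemma homotopic_sym X Y (f g : X -> Y) : homotopic R f g -> homotopic R g f.
Proof.
move=> /homotopicP[H [cH H0 H1]]; apply/homotopicP.
exists (fun p => H (p.1, 1 - p.2)); split=> [|x|x]; rewrite /= ?subr0 ?subrr //.
move=> p; apply: (@continuous_comp _ _ _ (fun p : X * R => (p.1, 1 - p.2)) H);
  last exact: cH.
apply: continuous_pair => q; first exact: cvg_fst.
by apply: continuousB; [exact: cst_continuous|exact: cvg_snd].
Qed.

Lemma homotopic_trans X Y (f g h : X -> Y) :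
  homotopic R f g -> homotopic R g h -> homotopic R f h.
Proof.
move=> /homotopicP[H [cH H0 H1]] /homotopicP[G [cG G0 G1]]; apply/homotopicP.
pose HG (p : X * R) :=
  if p.2 <= 1/2 then H (p.1, 2 * p.2) else G (p.1, 2 * p.2 - 1).
exists HG; split=> [|x|x]; last 2 first.
- by rewrite /HG /= divr_ge0 // mulr0.
- rewrite /HG /= ifF; last by apply/negbTE; lra.
  by rewrite mulr1 (_ : 2 - 1 = 1) // ?G1 //; lra.
pose A := [set p : X * R | p.2 <= 1/2].
pose B := [set p : X * R | p.2 >= 1/2].
have csnd : continuous (snd : X * R -> R) by move=> p; exact: cvg_snd.
have cA : closed A by apply: (@closed_comp _ _ _ [set t : R | t <= 1/2]) => //;
  exact: closed_le.
have cB : closed B by apply: (@closed_comp _ _ _ [set t : R | t >= 1/2]) => //;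
  exact: closed_ge.
apply/continuous_subspace_setT.
have -> : [set: X * R] = A `|` B.
  by apply/seteqP; split=> // p _; have [] := leP p.2 (1/2);
    [left|move=> /ltW; right].
have cdbl : continuous (fun p : X * R => 2 * p.2).
  by move=> p; apply: cvgM; [exact: cvg_cst|exact: csnd].
have cfst : continuous (fst : X * R -> X) by move=> p; exact: cvg_fst.
apply: withinU_continuous => //.
  apply: (@subspace_eq_continuous _ A _ (fun p => H (p.1, 2 * p.2)) HG).
    by move=> p; rewrite inE /HG /A /= => ->.
  apply: continuous_subspaceT => p.
  apply: (@continuous_comp _ _ _ (fun p : X * R => (p.1, 2 * p.2)) H); 
    last exact: cH.
  exact: continuous_pair.
apply: (@subspace_eq_continuous _ B _ (fun p => G (p.1, 2 * p.2 - 1)) HG).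
  move=> p; rewrite inE /HG /B /= => pB; case: ifPn => // pA.
  have -> : p.2 = 1/2 by apply/eqP; rewrite eq_le pA pB.
  by rewrite mul1r divff // subrr H1 G0.
apply: continuous_subspaceT => p.
apply: (@continuous_comp _ _ _ (fun p : X * R => (p.1, 2 * p.2 - 1)) G);
  last exact: cG.
apply: continuous_pair => // q.
by apply: cvgB; [exact: cdbl|exact: cvg_cst].
Qed.

Lemma homotopic_compl X Y Z (k : Y -> Z) (f g : X -> Y) :
  continuous k -> homotopic R f g -> homotopic R (k \o f) (k \o g).
Proof.
move=> ck /homotopicP[H [cH H0 H1]]; apply/homotopicP; exists (k \o H).
split=> [p|x|x]; rewrite /= ?H0 ?H1 //.
by apply: continuous_comp; [exact: cH|exact: ck].
Qed.

Lemma homotopic_compr X Y Z (k : Z -> X) (f g : X -> Y) :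
  continuous k -> homotopic R f g -> homotopic R (f \o k) (g \o k).
Proof.
move=> ck /homotopicP[H [cH H0 H1]]; apply/homotopicP.
exists (fun p => H (k p.1, p.2)).
split=> [p|x|x]; rewrite /= ?H0 ?H1 //.
apply: (@continuous_comp _ _ _ (fun p : Z * R => (k p.1, p.2)) H); 
  last exact: cH.
apply: continuous_pair => q; last exact: cvg_snd.
by apply: continuous_comp; [exact: cvg_fst|exact: ck].
Qed.

Lemma homotopy_equivalent_refl X : homotopy_equivalent R X X.
Proof.
have cid : continuous (@idfun X) by move=> x; exact: cvg_id.
by exists idfun, idfun; split=> //; exact: homotopic_refl.
Qed.

Lemma homotopy_equivalent_sym X Y :
  homotopy_equivalent R X Y -> homotopy_equivalent R Y X.
Proof. by move=> [f [g [cf cg gf fg]]]; exists g, f; split. Qed.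

Lemma homotopy_equivalent_trans Y X Z :
  homotopy_equivalent R X Y -> homotopy_equivalent R Y Z ->
  homotopy_equivalent R X Z.
Proof.
move=> [f [g [cf cg gf fg]]] [h [k [ch ck kh hk]]].
exists (h \o f), (g \o k); split; try exact: continuous_o.
- apply: homotopic_trans gf.
  exact: (homotopic_compl cg (homotopic_compr cf kh)).
- apply: homotopic_trans hk.
  exact: (homotopic_compl ch (homotopic_compr ck fg)).
Qed.

Lemma homotopy_equivalent_contractible X Y :
  homotopy_equivalent R X Y -> contractible R Y -> contractible R X.
Proof.
move=> [f [g [cf cg gf _]]] [y0 hy]; exists (g y0).
apply: homotopic_trans (homotopic_sym gf) _.
exact: (homotopic_compl cg (homotopic_compr cf hy)).
Qed.

Lemma homeomorphic_homotopy_equivalent X Y (f : X -> Y) (g : Y -> X) :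
  continuous f -> continuous g -> cancel f g -> cancel g f ->
  homotopy_equivalent R X Y.
Proof.
move=> cf cg fK gK; exists f, g; split=> //.
  have -> : g \o f = idfun by apply/funext => x; exact: fK.
  by apply: homotopic_refl => x; exact: cvg_id.
have -> : f \o g = idfun by apply/funext => x; exact: gK.
by apply: homotopic_refl => x; exact: cvg_id.
Qed.

Lemma compact_hausdorff_homotopy_equivalent X Y (f : X -> Y) (g : Y -> X) :
  compact [set: X] -> hausdorff_space Y ->
  continuous f -> cancel f g -> cancel g f -> homotopy_equivalent R X Y.
Proof.
move=> cX hY cf fK gK; apply: (@homeomorphic_homotopy_equivalent _ _ f g) => //.
apply/continuous_closedP => A cA.
have -> : g @^-1` A = f @` A.
  by apply/seteqP; split=> [y Ay|_ [x Ax <-]] /=; [exists (g y)|rewrite fK].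
apply: compact_closed => //; apply: continuous_compact.
  exact: continuous_subspaceT.
by apply: subclosed_compact cX _.
Qed.

Lemma set_type_compact X (A : set X) : compact A -> compact [set: A].
Proof.
move=> cA F FF _.
have [p [Ap clp]] : A `&` cluster (set_val @ F) !=set0.
  apply: cA; rewrite /= nbhs_simpl; apply: filterE => a; exact: set_valP.
exists (@exist _ (fun x => x \in A) p (mem_set Ap)); split=> // B C FB.
move=> [_ [[W oW <-]] /= Wp WC].
have [|_ [[b Bb <-] Wb]] := clp (set_val @` B) W _ (open_nbhs_nbhs (conj oW Wp)).
  by rewrite /= nbhs_simpl; apply: filterS FB => b Bb; exists b.
by exists b; split=> //; exact: WC.
Qed.

Lemma set_type_hausdorff X (A : set X) : hausdorff_space X -> hausdorff_space A.
Proof.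
move=> hX x y cxy; apply: val_inj; apply: hX => U V Ux Vy.
have cv : continuous (set_val : A -> X) by exact: initial_continuous.
by have [z [Uz Vz]] := cxy _ _ (cv x U Ux) (cv y V Vy); exists (set_val z).
Qed.

End Homotopy.

(** * Realizations of complexes *)

Definition down_closed (V : finType) (K : {set {set V}}) :=
  forall A B : {set V}, A \subset B -> B \in K -> A \in K.

Definition supp (R : realType) (V : finType) (x : V -> R) : {set V} :=
  finset (fun v => x v != 0%R).

Section Complexes.
Local Open Scope classical_set_scope.
Local Open Scope ring_scope.
Variables (R : realType) (V : finType).
Implicit Types (K : {set {set V}}) (A B : {set V}).

Definition rlz K (x : V -> R) (xK : realization_set R K x) : realization R K :=
  @exist _ (fun y => y \in realization_set R K) x (mem_set xK).

Lemma rlzP K (x : realization R K) : realization_set R K (val x).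
Proof. by case: x => x /= /set_mem. Qed.

Lemma rlz_coord_continuous K v :
  continuous (fun x : realization R K => (val x : V -> R) v).
Proof.
have cv : continuous (set_val : realization R K -> {ptws V -> R}).
  exact: initial_continuous.
exact: (continuous_o cv (@continuous_coord R V v)).
Qed.

Lemma continuous_rlz (X : topologicalType) K (f : X -> realization R K) :
  (forall v, continuous (fun x => (val (f x) : V -> R) v)) -> continuous f.
Proof.
by move=> cf; apply: continuous_comp_initial; apply: continuous_ptws.
Qed.

(** The straight-line homotopy never leaves the simplex [A] that contains both supports; [A] may
    vary with the point, since continuity is checked coordinatewise. *)
Lemma homotopic_contiguous (X : topologicalType) K (f g : X -> realization R K) :
  down_closed K -> continuous f -> continuous g ->
  (forall x, exists A, [/\ A \in K, supp (val (f x) : V -> R) \subset A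
                         & supp (val (g x) : V -> R) \subset A]) ->
  homotopic R f g.
Proof.
move=> dK cf cg fg; apply/homotopicP.
pose h (p : X * R) v : R := (1 - clamp p.2) * (val (f p.1) : V -> R) v
                             + clamp p.2 * (val (g p.1) : V -> R) v.
have hK p : realization_set R K (h p).
  have [f0 f1 fK] := rlzP (f p.1); have [g0 g1 gK] := rlzP (g p.1).
  have c0 := clamp_ge0 p.2; have c1 := clamp_le1 p.2.
  split.
  - by move=> v; rewrite addr_ge0 // mulr_ge0 // subr_ge0.
  - by rewrite big_split /= -!mulr_sumr f1 g1; ring.
  have [A [AK fA gA]] := fg p.1; apply: dK AK; apply/fintype.subsetP => v.
  rewrite inE /h; apply: contraNT => vA.
  have -> : (val (f p.1) : V -> R) v = 0.
    by apply: contraNeq vA => fv; apply: (fintype.subsetP fA); rewrite inE.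
  have -> : (val (g p.1) : V -> R) v = 0.
    by apply: contraNeq vA => fv; apply: (fintype.subsetP gA); rewrite inE.
  by rewrite !mulr0 addr0.
exists (fun p => rlz (hK p)); split=> [|x|x].
- apply: continuous_rlz => v p /=.
  have cc : continuous (fun q : X * R => clamp q.2).
    apply: (@continuous_o _ _ _ snd) => q; [exact: cvg_snd|exact: clamp_continuous].
  have cfst : continuous (fst : X * R -> X) by move=> q; exact: cvg_fst.
  apply: cvgD; apply: cvgM.
  + by apply: cvgB; [exact: cvg_cst|exact: cc].
  + exact: (continuous_o cfst (continuous_o cf (@rlz_coord_continuous K v))).
  + exact: cc.
  + exact: (continuous_o cfst (continuous_o cg (@rlz_coord_continuous K v))).
- apply: val_inj; apply/funext => v; rewrite /= /h /= clamp0; ring.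
- apply: val_inj; apply/funext => v; rewrite /= /h /= clamp1; ring.
Qed.

(** The identity and the constant map at [w] are contiguous: x and [w] lie in the simplex spanned by
    [w] and the support of x. *)
Lemma contractible_cone K (w : V) :
  down_closed K -> [set w]%SET \in K ->
  (forall A, A \in K -> (w |: A)%SET \in K) -> contractible R (realization R K).
Proof.
move=> dK wK cK; pose d (v : V) : R := (v == w)%:R.
have suppd : supp d = [set w]%SET.
  by apply/setP => v; rewrite !inE /d pnatr_eq0 eqb0 negbK.
have dP : realization_set R K d.
  split; first by move=> v; rewrite /d ler0n.
    rewrite (bigD1 w) //= /d eqxx big1 ?addr0 // => v /negbTE -> //.
  by rewrite -[finset _]/(supp d) suppd.
exists (rlz dP); apply: homotopic_contiguous => //.
- by move=> x; exact: cvg_id.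
- exact: cst_continuous.
move=> x; have [_ _ xK] := rlzP x.
exists (w |: supp (val x : V -> R))%SET; split; first exact: cK.
  exact: finset.subsetU1.
by rewrite suppd finset.sub1set setU11.
Qed.

(** The cardinality factor is 2, or 1 when [u = v], so that [w] receives exactly the mass removed
    from the set {u, v}. *)
Definition push (u v w : V) (x : V -> R) (z : V) : R :=
  let t := Num.min (x u) (x v) in
  x z + #|[set u; v]%SET|%:R * t * (z == w)%:R - t * (z \in [set u; v]%SET)%:R.

Lemma push_continuous u v w z :
  continuous (fun x : {ptws V -> R} => push u v w x z).
Proof.
have cz := @continuous_coord R V.
have ct := continuous_minr (cz u) (cz v).
apply: continuous_subr; last by apply: continuous_mulr => //; exact: cst_continuous.
apply: continuous_addr; first exact: cz.
apply: continuous_mulr; last exact: cst_continuous.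
by apply: continuous_mulr => //; exact: cst_continuous.
Qed.

Lemma push_id u v w (x : V -> R) : (forall z, 0 <= x z) ->
  ~~ ([set u; v]%SET \subset supp x) -> push u v w x = x.
Proof.
move=> x0 nuv; have t0 : Num.min (x u) (x v) = 0.
  apply/eqP; rewrite eq_le le_min !x0 !andbT ge_min.
  apply: contraNT nuv; rewrite negb_or -!ltNge => /andP[xu xv].
  by apply/fintype.subsetP => z; rewrite !inE => /orP[]/eqP->; rewrite gt_eqF.
by apply/funext => z; rewrite /push t0 mulr0 !mul0r addr0 subr0.
Qed.

Lemma supp_push u v w (x : V -> R) : [set u; v]%SET \subset supp x ->
  supp (push u v w x) \subset (w |: supp x)%SET.
Proof.
move=> uvx; apply/fintype.subsetP => z.
rewrite /push !inE; apply: contraNT; rewrite negb_or negbK.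
move=> /andP[/negbTE zw /eqP xz].
have -> : (z == u) || (z == v) = false.
  apply/negbTE/negP => zuv; have := fintype.subsetP uvx z.
  by rewrite !inE zuv xz eqxx => /(_ isT).
by rewrite zw xz !mulr0 addr0 subr0.
Qed.

Lemma pushP (K : {set {set V}}) u v w : down_closed K ->
  w != u -> w != v ->
  (forall A, A \in K -> [set u; v]%SET \subset A -> (w |: A)%SET \in K) ->
  forall x, realization_set R K x ->
  realization_set R [set A in K | ~~ ([set u; v]%SET \subset A)]%SET
    (push u v w x).
Proof.
move=> dK wu wv wK x [x0 x1 xK].
have wuv : w \notin [set u; v]%SET by rewrite !inE negb_or wu.
set t := Num.min (x u) (x v).
have t0 : 0 <= t by rewrite le_min !x0.
split.
- move=> z; rewrite /push -/t; case: (boolP (z \in _)) => zuv /=.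
    have -> : (z == w) = false by apply: contraNF wuv => /eqP <-.
    rewrite mulr0 addr0 mulr1 subr_ge0 /t; move: zuv; rewrite !inE.
    by case/orP => /eqP ->; rewrite ge_min lexx ?orbT.
  by rewrite mulr0 subr0 addr_ge0 // mulr_ge0 // mulr_ge0 // ler0n.
- rewrite /push -/t sumrB big_split /= x1 -!mulr_sumr.
  rewrite (bigD1 w) //= eqxx big1 ?addr0 => [|z /negbTE->//].
  rewrite -natr_sum -big_mkcond /= sum1_card; ring.
rewrite inE; case: (boolP ([set u; v]%SET \subset supp x)) => uvx; last first.
  by rewrite push_id // uvx andbT.
rewrite -[finset _]/(supp (push u v w x)); apply/andP; split.
  exact: dK (supp_push w uvx) (wK _ xK uvx).
apply/negP => /fintype.subsetP uvp.
(* The vertex where the minimum is attained ends with coordinate 0, as [w] is not in {u, v}; hence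
   {u, v} is no longer in the support. *)
have : exists2 z, z \in [set u; v]%SET & x z = t.
  rewrite /t; case: (leP (x u) (x v)) => h; [exists u|exists v] => //.
    by rewrite !inE eqxx.
  by rewrite !inE eqxx orbT.
case=> z zuv xz; have := uvp z zuv.
rewrite inE /push -/t zuv xz.
have -> : (z == w) = false by apply: contraNF wuv => /eqP <-.
by rewrite mulr0 addr0 mulr1 subrr eqxx.
Qed.

Lemma down_closed_setI K (P : pred {set V}) :
  down_closed K -> (forall A B, A \subset B -> P B -> P A) ->
  down_closed [set A in K | P A]%SET.
Proof.
move=> dK dP A B AB; rewrite !inE => /andP[BK PB].
by rewrite (dK _ _ AB BK) (dP _ _ AB PB).
Qed.

(* Straight-line deformation: the open star of the simplex {u, v} is pushed
   towards w, the apex of the link of {u, v}. *)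
Lemma collapse_coned_simplex (K : {set {set V}}) u v w : down_closed K ->
  w != u -> w != v ->
  (forall A, A \in K -> [set u; v]%SET \subset A -> (w |: A)%SET \in K) ->
  homotopy_equivalent R (realization R K)
    (realization R [set A in K | ~~ ([set u; v]%SET \subset A)]%SET).
Proof.
move=> dK wu wv wK; set K' := finset _.
have dK' : down_closed K'.
  by apply: down_closed_setI => // A B AB; apply: contraNN => /fintype.subset_trans ->.
have pP := pushP dK wu wv wK.
have iP x : realization_set R K' x -> realization_set R K x.
  by move=> [x0 x1]; rewrite inE => /andP[xK _].
pose f (x : realization R K) : realization R K' := rlz (pP _ (rlzP x)).
pose g (x : realization R K') : realization R K := rlz (iP _ (rlzP x)).
have cf : continuous f.
  apply: continuous_rlz => z.
  have cv : continuous (set_val : realization R K -> {ptws V -> R}).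
    exact: initial_continuous.
  exact: (continuous_o cv (@push_continuous u v w z)).
have cg : continuous g by apply: continuous_rlz => z; exact: rlz_coord_continuous.
exists f, g; split=> //.
- apply: homotopic_contiguous => //; first exact: continuous_o.
    by move=> x; exact: cvg_id.
  move=> x; have xP := rlzP x; have [x0 _ xK] := xP.
  case: (boolP ([set u; v]%SET \subset supp (val x : V -> R))) => uvx; last first.
    by exists (supp (val x : V -> R)); rewrite /= push_id //; split.
  exists (w |: supp (val x : V -> R))%SET; split; first exact: wK.
    exact: supp_push.
  exact: finset.subsetU1.
- have -> : f \o g = idfun; last by apply: homotopic_refl => x; exact: cvg_id.
  apply/funext => x; apply: val_inj; rewrite /= push_id //.
    by case: (rlzP x).
  by have [_ _] := rlzP x; rewrite inE => /andP[].
Qed.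

End Complexes.

(** * Wedges of cross-polytopes *)

Section SphereTopology.
Local Open Scope classical_set_scope.
Local Open Scope ring_scope.
Variables (R : realType) (d : nat).
Implicit Types y : 'rV[R]_d.+1.

Definition norm1 y : R := \sum_j `|y 0 j|.
Definition sqnorm y : R := \sum_j y 0 j ^+ 2.

Lemma rV_coord_continuous j : continuous (fun y => y 0 j : R).
Proof. exact: coord_continuous. Qed.

Lemma sqnorm_continuous : continuous sqnorm.
Proof.
apply: continuous_sumr => j.
under eq_fun do rewrite expr2.
by apply: continuous_mulr; exact: rV_coord_continuous.
Qed.

Lemma norm1_continuous : continuous norm1.
Proof.
apply: continuous_sumr => j.
by apply: (continuous_o (@rV_coord_continuous j)); exact: norm_continuous.
Qed.

Lemma sphere_compact : compact [set: sphere R d].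
Proof.
apply: set_type_compact.
have cB := @rV_compact R d.+1 (fun=> `[-1, 1]%classic) (fun=> @segment_compact R (-1) 1).
apply: subclosed_compact cB _.
  apply: (@closed_comp _ _ sqnorm [set 1]); first by move=> y _; exact: sqnorm_continuous.
  exact: closed_eq.
move=> y /= y1 j; rewrite in_itv /=.
have y1j : y 0 j ^+ 2 <= 1.
  by rewrite -y1 (bigD1 j) //= lerDl sumr_ge0 // => l _; exact: sqr_ge0.
by rewrite -ler_norml -(@expr_le1 _ 2) // real_normK ?num_real.
Qed.

Lemma norm1_gt0 y : y != 0 -> 0 < norm1 y.
Proof.
move=> y0; rewrite lt_neqAle sumr_ge0 ?andbT; last by move=> j _; exact: normr_ge0.
apply: contraNN y0; rewrite eq_sym psumr_eq0 => [/allP h|j _]; last exact: normr_ge0.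
apply/eqP/rowP => j; rewrite mxE; apply/eqP; rewrite -normr_eq0.
by apply: h; rewrite mem_index_enum.
Qed.

Lemma sqnorm_gt0 y : y != 0 -> 0 < sqnorm y.
Proof.
move=> y0; rewrite lt_neqAle sumr_ge0 ?andbT; last by move=> j _; exact: sqr_ge0.
apply: contraNN y0; rewrite eq_sym psumr_eq0 => [/allP h|j _]; last exact: sqr_ge0.
apply/eqP/rowP => j; rewrite mxE; apply/eqP; rewrite -sqrf_eq0.
by apply: h; rewrite mem_index_enum.
Qed.

Lemma sphere_neq0 y : sphere R d y -> y != 0.
Proof.
rewrite /sphere /= => y1; apply/eqP => y0; move/eqP: y1.
by rewrite y0 big1 ?(eq_sym 0) ?oner_eq0 // => j _; rewrite mxE expr0n.
Qed.

Lemma norm1Z (a : R) y : norm1 (a *: y) = `|a| * norm1 y.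
Proof. by rewrite /norm1 mulr_sumr; apply: eq_bigr => j _; rewrite mxE normrM. Qed.

Lemma sqnormZ (a : R) y : sqnorm (a *: y) = a ^+ 2 * sqnorm y.
Proof. by rewrite /sqnorm mulr_sumr; apply: eq_bigr => j _; rewrite mxE exprMn. Qed.

Definition normalize y := (Num.sqrt (sqnorm y))^-1 *: y.

Lemma normalize_sphere y : y != 0 -> sphere R d (normalize y).
Proof.
move=> y0; rewrite /sphere /= -/(sqnorm _) sqnormZ exprVn sqr_sqrtr.
  by rewrite mulVf // gt_eqF // sqnorm_gt0.
by rewrite ltW // sqnorm_gt0.
Qed.

Lemma normalizeZ (a : R) y : 0 < a -> sphere R d y -> normalize (a *: y) = y.
Proof.
move=> a0 y1; rewrite /normalize sqnormZ (_ : sqnorm y = 1) // mulr1.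
by rewrite sqrtr_sqr gtr0_norm // scalerA mulVf ?scale1r // gt_eqF.
Qed.

End SphereTopology.

(** * Round spheres as boundaries of cross-polytopes *)

Section CrossPolytopes.
Local Open Scope classical_set_scope.
Local Open Scope ring_scope.
Variables (R : realType) (V : finType) (K : {set {set V}}).
Variables (k : nat) (d : 'I_k.+1 -> nat).
Variables (p q : forall i : 'I_k.+1, 'I_(d i).+1 -> V) (c : V).
Arguments p : clear implicits.
Arguments q : clear implicits.

Definition cross_vertices i : {set V} :=
  finset (fun v => [exists j, (v == p i j) || (v == q i j)]).

(** Faces of the boundary of the cross-polytope whose antipodal pairs are [p i j], [q i j]. *)
Definition cross_face i (A : {set V}) :=
  (A \subset cross_vertices i) &&
  [forall j, ~~ ((p i j \in A) && (q i j \in A))].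

Hypothesis p_inj : forall i, injective (p i).
Hypothesis q_inj : forall i, injective (q i).
Hypothesis p_neq_q : forall i j j', p i j != q i j'.
Hypothesis p_base : forall i, p i ord0 = c.
Hypothesis cross_meet : forall i i' v, i != i' ->
  v \in cross_vertices i -> v \in cross_vertices i' -> v = c.
Hypothesis K_faces : forall A, (A \in K) = [exists i, cross_face i A].

Definition place i (a b : 'I_(d i).+1 -> R) (v : V) : R :=
  \sum_j ((v == p i j)%:R * a j + (v == q i j)%:R * b j).
Arguments place : clear implicits.

Lemma place_p i a b j : place i a b (p i j) = a j.
Proof.
rewrite /place (bigD1 j) //= eqxx mul1r (negbTE (p_neq_q j j)) mul0r addr0.
rewrite big1 ?addr0 // => j' j'j; rewrite (inj_eq (@p_inj i)) eq_sym (negbTE j'j).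
by rewrite (negbTE (p_neq_q _ _)) !mul0r addr0.
Qed.

Lemma place_q i a b j : place i a b (q i j) = b j.
Proof.
rewrite /place (bigD1 j) //= eqxx mul1r eq_sym (negbTE (p_neq_q j j)) mul0r add0r.
rewrite big1 ?addr0 // => j' j'j; rewrite (inj_eq (@q_inj i)) [j == _]eq_sym.
by rewrite (negbTE j'j) eq_sym (negbTE (p_neq_q _ _)) !mul0r addr0.
Qed.

Lemma place_out i a b v : v \notin cross_vertices i -> place i a b v = 0.
Proof.
rewrite inE negb_exists => /forallP h; rewrite /place big1 // => j _.
by have := h j; rewrite negb_or => /andP[/negbTE -> /negbTE ->]; rewrite !mul0r addr0.
Qed.

Lemma sum_place i a b : \sum_v place i a b v = \sum_j (a j + b j).
Proof.
rewrite exchange_big /=; apply: eq_bigr => j _.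
rewrite big_split /= -!mulr_suml; congr (_ + _).
  by rewrite (bigD1 (p i j)) //= eqxx big1 ?addr0 ?mul1r // => v /negbTE ->.
by rewrite (bigD1 (q i j)) //= eqxx big1 ?addr0 ?mul1r // => v /negbTE ->.
Qed.

Lemma placeE i (x : V -> R) : supp x \subset cross_vertices i ->
  x = place i (x \o p i) (x \o q i).
Proof.
move=> xi; apply/funext => v; case: (boolP (v \in cross_vertices i)) => vi.
  move: (vi); rewrite inE => /existsP[j /orP[]/eqP->].
    by rewrite place_p.
  by rewrite place_q.
rewrite place_out //; apply: contraNeq vi => xv.
by apply: (fintype.subsetP xi); rewrite inE.
Qed.

(** Radial projection to the l1-sphere, in barycentric coordinates: positive parts sit on the
    vertices [p], negative parts on their antipodes [q]. *)
Definition to_cross i (y : 'rV[R]_(d i).+1) : V -> R :=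
  place i (fun j => Num.max (y 0 j) 0 / norm1 y)
          (fun j => Num.max (- y 0 j) 0 / norm1 y).
Arguments to_cross : clear implicits.

Lemma maxrN_eq (a : R) : Num.max a 0 + Num.max (- a) 0 = `|a|.
Proof.
case: (leP 0 a) => a0.
  by rewrite max_r ?oppr_le0 // addr0 ger0_norm.
by rewrite max_l ?oppr_ge0 ?ltW // add0r ltr0_norm.
Qed.

Lemma maxrN_sub (a : R) : Num.max a 0 - Num.max (- a) 0 = a.
Proof.
case: (leP 0 a) => a0; first by rewrite max_r ?oppr_le0 // subr0.
by rewrite max_l ?oppr_ge0 ?ltW // sub0r opprK.
Qed.

Lemma to_crossP i y : sphere R (d i) y -> realization_set R K (to_cross i y).
Proof.
move=> y1; have n0 := norm1_gt0 (sphere_neq0 y1).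
have supi : supp (to_cross i y) \subset cross_vertices i.
  apply/fintype.subsetP => v; rewrite inE; apply: contraNT => vi.
  by rewrite /to_cross place_out.
have max0 (a : R) : 0 <= Num.max a 0 by rewrite le_max lexx orbT.
split.
- move=> v; rewrite /to_cross /place sumr_ge0 // => j _.
  by rewrite addr_ge0 // mulr_ge0 ?ler0n // divr_ge0 // ltW.
- rewrite sum_place; under eq_bigr do rewrite -mulrDl maxrN_eq.
  by rewrite -mulr_suml divff // gt_eqF.
rewrite K_faces; apply/existsP; exists i; apply/andP; split=> //.
apply/forallP => j; rewrite !inE /to_cross place_p place_q.
rewrite -negb_or negbK !mulf_eq0 invr_eq0 (gt_eqF n0) !orbF.
case: (leP 0 (y 0 j)) => yj; last by rewrite eqxx.
by rewrite max_r ?oppr_le0 // eqxx orbT.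
Qed.

Definition of_cross i (x : V -> R) : 'rV[R]_(d i).+1 :=
  \row_j (x (p i j) - x (q i j)).

Lemma to_crossK i y : sphere R (d i) y ->
  normalize (of_cross i (to_cross i y)) = y.
Proof.
move=> y1; have n0 := norm1_gt0 (sphere_neq0 y1).
have -> : of_cross i (to_cross i y) = (norm1 y)^-1 *: y.
  apply/rowP => j; rewrite !mxE /to_cross place_p place_q -mulrBl maxrN_sub.
  by rewrite mulrC.
by apply: normalizeZ => //; rewrite invr_gt0.
Qed.

Lemma of_crossK i x : realization_set R K x -> cross_face i (supp x) ->
  of_cross i x != 0 /\ to_cross i (normalize (of_cross i x)) = x.
Proof.
move=> [x0 x1 _] /andP[xi /forallP excl]; set y := of_cross i x.
(* A face omits one vertex of each antipodal pair, so one of the two coordinates vanishes and their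
   difference determines both. *)
have yj j : (0 <= y 0 j /\ x (p i j) = y 0 j /\ x (q i j) = 0) \/
            (y 0 j <= 0 /\ x (p i j) = 0 /\ x (q i j) = - y 0 j).
  have := excl j; rewrite !inE -negb_or negbK mxE => /orP[]/eqP e.
    by right; rewrite e sub0r oppr_le0 opprK; split.
  by left; rewrite e subr0; split.
(* For the same reason the l1-norm of the differences is the sum of the barycentric coordinates. *)
have n1 : norm1 y = 1.
  rewrite -x1 (placeE xi) sum_place; apply: eq_bigr => j _ /=.
  have [[h [-> ->]]|[h [-> ->]]] := yj j; first by rewrite addr0 ger0_norm.
  by rewrite add0r ler0_norm.
have y0 : y != 0.
  apply/eqP => y0; move/eqP: n1; rewrite y0 /norm1 big1 ?(eq_sym 0) ?oner_eq0 //.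
  by move=> j _; rewrite mxE normr0.
split=> //; rewrite [RHS](placeE xi) /to_cross /normalize.
set s := Num.sqrt _; have s0 : 0 < s by rewrite sqrtr_gt0 sqnorm_gt0.
have sV0 : 0 <= s^-1 by rewrite invr_ge0 ltW.
rewrite norm1Z n1 mulr1 ger0_norm // invrK; congr place; apply/funext => j /=;
  rewrite mxE; have [[h [e1 e2]]|[h [e1 e2]]] := yj j; rewrite ?e1 ?e2.
- by rewrite max_l ?mulr_ge0 // mulrAC mulVf ?mul1r // gt_eqF.
- by rewrite max_r ?mul0r // mulr_ge0_le0.
- by rewrite max_r ?mul0r // oppr_le0 mulr_ge0.
- by rewrite max_l ?oppr_ge0 ?mulr_ge0_le0 // -mulrN mulrAC mulVf ?mul1r // gt_eqF.
Qed.

Lemma realization_vertex (x : V -> R) : realization_set R K x ->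
  supp x \subset [set c]%SET -> x = fun v => (v == c)%:R.
Proof.
move=> [_ x1 _] xc; have x0 v : v != c -> x v = 0.
  move=> vc; apply: contraNeq vc => xv.
  by have := fintype.subsetP xc v; rewrite !inE xv => /(_ isT).
apply/funext => v; case: eqVneq => [->|vc]; last by rewrite x0.
by rewrite -x1 (bigD1 c) //= big1 ?addr0.
Qed.

Definition cross_map i (y : sphere R (d i)) : realization R K :=
  rlz (to_crossP (set_mem (valP y))).

Lemma cross_map_continuous i : continuous (@cross_map i).
Proof.
apply: continuous_rlz => v; rewrite /= /to_cross /place.
have cv : continuous (set_val : sphere R (d i) -> 'rV[R]_(d i).+1).
  exact: initial_continuous.
have cc j : continuous (fun y : sphere R (d i) => (val y : 'rV[R]_(d i).+1) 0 j).
  exact: (continuous_o cv (@rV_coord_continuous R _ j)).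
have cn : continuous (fun y : sphere R (d i) => (norm1 (val y : 'rV[R]_(d i).+1))^-1).
  apply: continuous_invr.
    exact: (continuous_o cv (@norm1_continuous R _)).
  by move=> y; rewrite gt_eqF // norm1_gt0 //; exact/sphere_neq0/set_mem/(valP y).
apply: continuous_sumr => j; apply: continuous_addr.
  apply: continuous_mulr; first exact: cst_continuous.
  apply: continuous_mulr => //; apply: continuous_maxr => //; exact: cst_continuous.
apply: continuous_mulr; first exact: cst_continuous.
apply: continuous_mulr => //; apply: continuous_maxr; last exact: cst_continuous.
exact: continuous_oppr.
Qed.

Lemma supp_cross_map i (y : sphere R (d i)) :
  supp (val (cross_map y) : V -> R) \subset cross_vertices i.
Proof.
apply/fintype.subsetP => v; rewrite inE; apply: contraNT => vi.
by rewrite /= /to_cross place_out.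
Qed.

(** All base points go to the common vertex [c], which lets the maps glue to one map on the
    wedge. *)
Lemma cross_map_base i :
  (val (cross_map (sphere_base R (d i))) : V -> R) = fun v => (v == c)%:R.
Proof.
apply: realization_vertex; first exact: rlzP.
apply/fintype.subsetP => v v_s; rewrite inE.
have := fintype.subsetP (supp_cross_map _) _ v_s.
move: v_s; rewrite !inE /= => vs /existsP[j /orP[]/eqP vE]; move: vs; rewrite {}vE.
  rewrite /to_cross place_p mxE eqxx /=; case: (eqVneq j ord0) => [->|_].
    by rewrite p_base.
  by rewrite maxxx mul0r eqxx.
by rewrite /to_cross place_q max_r ?mul0r ?eqxx // oppr_le0 mxE ler0n.
Qed.

Lemma cross_map_inj i : injective (@cross_map i).
Proof.
move=> y z /(congr1 val) /= yz; apply: val_inj.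
rewrite -(to_crossK (set_mem (valP y))) -(to_crossK (set_mem (valP z))).
by rewrite yz.
Qed.

Lemma cross_map_eq_base i (y : sphere R (d i)) :
  supp (val (cross_map y) : V -> R) \subset [set c]%SET -> y = sphere_base R (d i).
Proof.
move=> yc; apply: (@cross_map_inj i); apply: val_inj.
by rewrite cross_map_base; apply: realization_vertex => //; exact: rlzP.
Qed.

(* A continuous bijection from the compact wedge onto the Hausdorff realization. *)
Lemma cross_polytopes_wedge :
  homotopy_equivalent R (realization R K) (wedge_of_spheres R d).
Proof.
apply: homotopy_equivalent_sym.
pose W := wedge_of_spheres R d.
pose lift i (y : sphere R (d i)) : W := wedge_lift (fun i => sphere_base R (d i)) y.
have fE i j : cross_map (sphere_base R (d i)) = cross_map (sphere_base R (d j)).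
  by apply: val_inj; rewrite !cross_map_base.
pose f : W -> realization R K :=
  wedge_fun (p0 := fun i => sphere_base R (d i)) cross_map.
have f_lift i y : f (lift i y) = cross_map y.
  exact: (@wedge_lift_funE _ _ (fun i => sphere_base R (d i))).
have liftP (z : W) : exists i, exists y, z = lift i y.
  have : [set: W] z by []; rewrite -wedgeTE => -[i _ [y _ <-]].
  by exists i, y.
have cf : continuous f.
  apply: wedge_fun_continuous => // i; exact: cross_map_continuous.
have f_inj : injective f.
  move=> z z'; have [i [y ->]] := liftP z; have [i' [y' ->]] := liftP z'.
  rewrite !f_lift; case: (eqVneq i i') => [ii'|ii' e].
    by case: i' / ii' y' => y' /cross_map_inj ->.
  (* Points on different spheres with the same image have it supported in both cross-polytopes,
     hence at [c]; both are then base points, which the wedge identifies. *)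
  have sc : supp (val (cross_map y) : V -> R) \subset [set c]%SET.
    apply/fintype.subsetP => v vs; rewrite inE; apply/eqP; apply: (cross_meet ii').
      exact: (fintype.subsetP (supp_cross_map y)).
    by apply: (fintype.subsetP (supp_cross_map y')); rewrite -e.
  have -> := cross_map_eq_base sc.
  rewrite e in sc; have -> := cross_map_eq_base sc.
  exact: wedge_liftE.
have f_surj x : exists z, f z = x.
  have xP := rlzP x; have [_ _] := xP; rewrite K_faces => /existsP[i xi].
  have [y0 yK] := of_crossK xP xi; have yS := normalize_sphere y0.
  exists (lift i (@exist _ (fun x => x \in sphere R (d i)) _ (mem_set yS))).
  by rewrite f_lift; apply: val_inj; rewrite /= yK.
pose g x := projT1 (cid (f_surj x)).
have gK : cancel g f by move=> x; rewrite /g; case: cid.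
apply: (@compact_hausdorff_homotopy_equivalent R _ _ f g) => //.
- apply: wedge_compact => [|i]; [exact: finite_finset|exact: sphere_compact].
- apply: set_type_hausdorff; apply: hausdorff_product => v.
  exact: Rhausdorff.
- by move=> z; apply: f_inj; rewrite gK.
Qed.

End CrossPolytopes.

(** * Graphs as edge lists *)

Section EdgeLists.
Variables (R : realType) (V : finType).
Implicit Types (E D : seq (V * V)) (u v w x y z : V) (N s t L : seq V).

Definition edge_complex E : {set {set V}} := independence_complex [rel x y | (x, y) \in E].

Definition linked E x y := ((x, y) \in E) || ((y, x) \in E).

(** Multiplicities are kept, so that [uniq (ends ps)] says that the pairs in [ps] are disjoint and
    nondegenerate. *)
Fixpoint ends E : seq V :=
  if E is e :: E' then [:: e.1, e.2 & ends E'] else [::].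

Definition loops L : seq (V * V) := [seq (x, x) | x <- L].

Definition nbrs_in w N E :=
  all (fun e => ((e.1 == w) ==> (e.2 \in N)) && ((e.2 == w) ==> (e.1 \in N))) E.

Definition heq E E' :=
  homotopy_equivalent R (realization R (edge_complex E)) (realization R (edge_complex E')).

Lemma in_edge_complex E A :
  (A \in edge_complex E) = all (fun e => ~~ ((e.1 \in A) && (e.2 \in A))) E.
Proof.
rewrite inE; apply/forall_inP/allP => [h [x y] /= xyE|h x xA].
  apply/negP => /andP[xA yA].
  by have /forall_inP/(_ y yA) := h x xA; rewrite /= xyE.
by apply/forall_inP => y yA; apply/negP => /h /=; rewrite xA yA.
Qed.

Lemma edge_complex_down_closed E : down_closed (edge_complex E).
Proof.
move=> A B /fintype.subsetP AB; rewrite !in_edge_complex; apply: sub_all => e.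
by apply: contraNN => /andP[/AB -> /AB ->].
Qed.

Lemma eq_edge_complex E E' : E =i E' -> edge_complex E = edge_complex E'.
Proof. by move=> EE'; apply/setP => A; rewrite !in_edge_complex; exact: eq_all_r. Qed.

(* Edges at a looped vertex do not matter, since a loop deletes its vertex. *)
Definition implied E (e : V * V) :=
  [|| linked E e.1 e.2, (e.1, e.1) \in E | (e.2, e.2) \in E].

Lemma implied_mem E x y : (x, y) \in E -> implied E (x, y).
Proof. by rewrite /implied /linked /= => ->. Qed.

Lemma implied_swap E x y : (y, x) \in E -> implied E (x, y).
Proof. by rewrite /implied /linked /= => ->; rewrite orbT. Qed.

Lemma implied_loopl E x y : (x, x) \in E -> implied E (x, y).
Proof. by rewrite /implied /= => ->; rewrite orbT. Qed.

Lemma implied_loopr E x y : (y, y) \in E -> implied E (x, y).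
Proof. by rewrite /implied /= => ->; rewrite !orbT. Qed.

Lemma edge_complex_sub E E' : all (implied E') E -> edge_complex E' \subset edge_complex E.
Proof.
move=> /allP EE'; apply/fintype.subsetP => A; rewrite !in_edge_complex => /allP AE'.
by apply/allP => e /EE' /or3P[/orP[]||] /AE' /=; rewrite ?andbb // => h;
  apply: contraNN h => /andP[h1 h2]; rewrite ?h1 ?h2.
Qed.

Lemma edge_complex_implied E E' :
  all (implied E') E -> all (implied E) E' -> edge_complex E = edge_complex E'.
Proof. by move=> h h'; apply/eqP; rewrite finset.eqEsubset !edge_complex_sub. Qed.

Lemma nbrs_in_out w N E : w \notin ends E -> nbrs_in w N E.
Proof.
elim: E => //= e E IH; rewrite !inE !negb_or => /and3P[/negbTE e1 /negbTE e2 wE].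
by rewrite eq_sym e1 eq_sym e2 IH.
Qed.

Lemma nbrs_in_cat w N E E' :
  nbrs_in w N (E ++ E') = nbrs_in w N E && nbrs_in w N E'.
Proof. exact: all_cat. Qed.

Lemma ends_cat E E' : ends (E ++ E') = ends E ++ ends E'.
Proof. by elim: E => //= e E ->. Qed.

Lemma endsP E v : reflect (exists2 e, e \in E & v = e.1 \/ v = e.2) (v \in ends E).
Proof.
elim: E => [|e E IH] /=; first by constructor => -[].
rewrite !inE orbA; apply: (iffP orP) => [[/orP[]/eqP->|/IH[e' e'E h]]|[e']].
- by exists e; rewrite ?inE ?eqxx //; left.
- by exists e; rewrite ?inE ?eqxx //; right.
- by exists e'; rewrite ?inE ?e'E ?orbT.
rewrite inE => /predU1P[->|e'E] h; last by right; apply/IH; exists e'.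
by left; case: h => ->; rewrite eqxx ?orbT.
Qed.

Lemma in_ends E e : e \in E -> (e.1 \in ends E) && (e.2 \in ends E).
Proof. by move=> eE; apply/andP; split; apply/endsP; exists e; auto. Qed.

(** Only a neighbour of [w] in [A], or a loop at [w], could spoil independence; [w \notin N]
    excludes the loop. *)
Lemma edge_complex_cone_step E w N A : w \notin N -> nbrs_in w N E -> A \in edge_complex E ->
  (forall n, n \in N -> n \notin A) -> (w |: A)%SET \in edge_complex E.
Proof.
move=> wN nE AE NA; rewrite in_edge_complex; apply/allP => e eE.
move: AE; rewrite in_edge_complex => /allP/(_ e eE).
have /allP/(_ e eE)/andP[/implyP h1 /implyP h2] := nE.
rewrite !inE; case: eqP => [e1|_] /=; last first.
  case: eqP => [e2|_] //= _; rewrite andbT; apply: NA; apply: h2; exact/eqP.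
have /NA e2A : e.2 \in N by apply: h1; exact/eqP.
rewrite (negbTE e2A) orbF => _; apply: contraNN wN => /eqP <-.
by apply: h1; exact/eqP.
Qed.

(** All neighbours of [w] are deleted by loops, so [w] is isolated in what remains and is a cone
    apex. *)
Lemma edge_complex_contractible E w N : w \notin N -> nbrs_in w N E ->
  all (fun n => (n, n) \in E) N -> contractible R (realization R (edge_complex E)).
Proof.
move=> wN nE /allP loopN.
have NA A n : A \in edge_complex E -> n \in N -> n \notin A.
  by rewrite in_edge_complex => /allP AE /loopN /AE /=; rewrite andbb.
have dE := @edge_complex_down_closed E.
have eE : (finset.set0 : {set V}) \in edge_complex E.
  by rewrite in_edge_complex; apply/allP => e _; rewrite inE.
apply: (@contractible_cone R V (edge_complex E) w) => //.
  rewrite -[[set w]%SET]finset.setU0; apply: (edge_complex_cone_step wN nE eE) => n _.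
  by rewrite inE.
by move=> A AE; apply: (edge_complex_cone_step wN nE AE) => n; exact: NA.
Qed.

(** An independent set containing [u] and [v] avoids all neighbours of [w], so the link of {u, v} is
    a cone with apex [w]. The third alternative covers neighbours already deleted. For [u = v] this
    is the fold lemma: N(w) <= N(u) permits deleting [u]. *)
Lemma heq_add_edge E u v w N : w != u -> w != v -> w \notin N ->
  nbrs_in w N E -> all (fun n => [|| linked E n u, linked E n v | (n, n) \in E]) N ->
  heq E ((u, v) :: E).
Proof.
move=> wu wv wN nE /allP hN; rewrite /heq.
have -> : edge_complex ((u, v) :: E) =
    [set A in edge_complex E | ~~ ([set u; v]%SET \subset A)]%SET.
  apply/setP => A; rewrite in_edge_complex [RHS]finset.in_set in_edge_complex /= finset.subUset.
  by rewrite !finset.sub1set andbC.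
apply: collapse_coned_simplex wu wv _; first exact: edge_complex_down_closed.
move=> A AE; rewrite finset.subUset !finset.sub1set => /andP[uA vA].
apply: (edge_complex_cone_step wN nE AE) => n /hN.
move: AE; rewrite in_edge_complex => /allP AE.
by case/or3P => [/orP[]|/orP[]|] /AE /=; rewrite ?uA ?vA ?andbT ?andbb.
Qed.

Lemma heq_refl E : heq E E.
Proof. exact: homotopy_equivalent_refl. Qed.

Lemma heq_sym E E' : heq E E' -> heq E' E.
Proof. exact: homotopy_equivalent_sym. Qed.

Lemma heq_trans E' E E'' : heq E E' -> heq E' E'' -> heq E E''.
Proof. exact: homotopy_equivalent_trans. Qed.

Lemma heq_implied E E' : all (implied E') E -> all (implied E) E' -> heq E E'.
Proof. by move=> h h'; rewrite /heq (edge_complex_implied h h'); exact: heq_refl. Qed.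

(** One vertex [w] serves for all edges of [D]: since [w] is not an end of [D], its neighbourhood
    does not grow while they are added. *)
Lemma heq_add_edges D E w N : w \notin ends D -> w \notin N -> nbrs_in w N E ->
  all (fun e => all (fun n =>
    [|| linked E n e.1, linked E n e.2 | (n, n) \in E]) N) D ->
  heq E (D ++ E).
Proof.
move=> + wN nE; elim: D => [_ _|[u v] D IH] /=; first exact: heq_refl.
rewrite !inE !negb_or => /and3P[wu wv wD] /andP[hN hD].
apply: heq_trans (IH wD hD) _; apply: (heq_add_edge wu wv wN).
  by rewrite nbrs_in_cat nE andbT; exact: nbrs_in_out.
apply: sub_all hN => n; rewrite /linked !mem_cat.
by case/or3P => [/orP[]|/orP[]|] ->; rewrite !orbT.
Qed.

(* A path a-x-y-z-b with inner vertices of degree 2: adding ab is free because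
   y is then a cone point, after which zb can be dropped thanks to x, and x is
   dominated by z. *)
Lemma heq_subdivided_edge E a x y z b :
  uniq [:: a; x; y; z; b] -> x \notin ends E -> y \notin ends E ->
  z \notin ends E ->
  heq [:: (a, x), (x, y), (y, z), (z, b) & E]
      [:: (a, b), (y, z), (x, x) & E].
Proof.
rewrite /= !inE !negb_or => /and5P[/and4P[ax ay az ab]] /and3P[xy xz xb].
move=> /andP[yz yb] zb _ xE yE zE.
have sy (p q : V) : p != q -> (q == p) = false by rewrite eq_sym => /negbTE.
have neqs := (negbTE ax, negbTE ay, negbTE az, negbTE xy, negbTE xz, negbTE xb,
  negbTE yz, negbTE yb, negbTE zb, sy _ _ ax, sy _ _ ay, sy _ _ az, sy _ _ xy,
  sy _ _ xz, sy _ _ xb, sy _ _ yz, sy _ _ yb, sy _ _ zb).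
pose E1 := [:: (a, b), (a, x), (x, y), (y, z) & E].
apply: (@heq_trans ((a, b) :: [:: (a, x), (x, y), (y, z), (z, b) & E])).
  apply: (@heq_add_edge _ _ _ y [:: x; z]).
  - by rewrite eq_sym.
  - by [].
  - by rewrite !inE negb_or eq_sym xy.
  - by rewrite /= !inE !eqxx !neqs (nbrs_in_out _ yE).
  - by rewrite /= /linked !inE !eqxx !orbT.
apply: (@heq_trans E1).
  (* After reordering, zb is dropped by reading its addition backwards: the neighbours of x are a,
     adjacent to b, and y, adjacent to z. *)
  apply: (@heq_trans ((z, b) :: E1)).
    apply: heq_implied; apply/allP => e; rewrite !inE => he;
    by rewrite /implied /linked !inE; move: he; case: e => e1 e2 /=;
      do ![case/orP => [->|]; rewrite ?orbT //]; move=> ->; rewrite ?orbT.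
  apply: heq_sym; apply: (@heq_add_edge _ _ _ x [:: a; y]) => //.
  - by rewrite !inE negb_or eq_sym ax.
  - by rewrite /= !inE !eqxx !neqs (nbrs_in_out _ xE).
  - by rewrite /= /linked !inE !eqxx !orbT.
apply: (@heq_trans ((x, x) :: E1)).
  apply: (@heq_add_edge _ _ _ z [:: y]).
  - by rewrite eq_sym.
  - by rewrite eq_sym.
  - by rewrite !inE eq_sym.
  - by rewrite /= !inE !eqxx !neqs (nbrs_in_out _ zE).
  - by rewrite /= /linked !inE !eqxx !orbT.
(* The loop at x makes the edges ax and xy redundant. *)
apply: heq_implied; rewrite /= /implied /linked !inE !eqxx ?orbT /=;
  by apply/allP => e eE; rewrite -!surjective_pairing !inE eE !orbT.
Qed.

End EdgeLists.

(** * Contractible or a wedge of spheres *)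

Section Outcomes.
Variables (R : realType) (V : finType).
Implicit Types (E D ps : seq (V * V)) (u v w x y z : V) (N s t L X Y : seq V).

Lemma size_ends ps : size (ends ps) = (size ps).*2.
Proof. by elim: ps => //= e ps ->; rewrite doubleS. Qed.

Lemma nth_ends c ps j : (j < size ps)%N ->
  nth c (ends ps) j.*2 = (nth (c, c) ps j).1 /\
  nth c (ends ps) j.*2.+1 = (nth (c, c) ps j).2.
Proof. by elim: ps j => //= e ps IH [|j] //= /IH. Qed.

Lemma ends_nthP c ps v : reflect
  (exists2 j, (j < size ps)%N &
     v = (nth (c, c) ps j).1 \/ v = (nth (c, c) ps j).2) (v \in ends ps).
Proof.
apply: (iffP (endsP _ _)) => [[e /(nthP (c, c))[j jps <-] h]|[j jps h]].
  by exists j.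
by exists (nth (c, c) ps j); first exact: mem_nth.
Qed.

Definition pair_free ps (A : {set V}) :=
  all (fun e => ~~ ((e.1 \in A) && (e.2 \in A))) ps.

Lemma wedge_of_pair_lists (K : {set {set V}}) (k : nat)
    (P : 'I_k.+1 -> seq (V * V)) (c : V) :
  (forall i, uniq (ends (P i))) ->
  (forall i, ohead (ends (P i)) = Some c) ->
  (forall i i' v, i != i' -> v \in ends (P i) -> v \in ends (P i') -> v = c) ->
  (forall A, (A \in K) =
     [exists i, (A \subset ends (P i)) && pair_free (P i) A]) ->
  exists d : 'I_k.+1 -> nat,
    homotopy_equivalent R (realization R K) (wedge_of_spheres R d).
Proof.
(* The boundary of a cross-polytope with d + 1 antipodal pairs is a d-sphere. *)
move=> uP hP mP KP; pose d (i : 'I_k.+1) := (size (P i)).-1.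
have sz i : size (P i) = (d i).+1 by rewrite /d; case: (P i) (hP i).
have lt i (j : 'I_(d i).+1) : (j < size (P i))%N by rewrite sz.
pose p i (j : 'I_(d i).+1) := (nth (c, c) (P i) j).1.
pose q i (j : 'I_(d i).+1) := (nth (c, c) (P i) j).2.
have pq i (j : 'I_(d i).+1) : p i j = nth c (ends (P i)) j.*2 /\
                              q i j = nth c (ends (P i)) j.*2.+1.
  by have [-> ->] := nth_ends c (lt i j).
have lt2 i (j : 'I_(d i).+1) : (j.*2.+1 < size (ends (P i)))%N.
  by rewrite size_ends sz; have := ltn_ord j; lia.
have vE i v : (v \in cross_vertices p q i) = (v \in ends (P i)).
  rewrite inE; apply/existsP/(ends_nthP c).
    by move=> [j /orP[]/eqP->]; exists (val j); rewrite ?lt //; [left|right].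
  rewrite sz => -[j jd h]; exists (Ordinal jd); rewrite /p /q /=.
  by case: h => ->; rewrite eqxx ?orbT.
exists d; apply: (@cross_polytopes_wedge R V K k d p q c).
- move=> i j j'; have [-> _] := pq i j; have [-> _] := pq i j' => /eqP.
  by rewrite nth_uniq ?uP ?(ltnW (lt2 _ _)) // => /eqP /double_inj /val_inj.
- move=> i j j'; have [_ ->] := pq i j; have [_ ->] := pq i j' => /eqP.
  by rewrite nth_uniq ?uP // eqSS => /eqP /double_inj /val_inj.
- move=> i j j'; have [-> _] := pq i j; have [_ ->] := pq i j'.
  by rewrite nth_uniq ?uP ?(ltnW (lt2 _ _)) //; apply/eqP; lia.
- move=> i; have [-> _] := pq i ord0; have := hP i.
  by case: (ends (P i)) => //= x l [->].
- by move=> i i' v ii'; rewrite !vE; exact: mP.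
move=> A; rewrite KP; apply: eq_existsb => i; congr andb.
  by apply: eq_subset_r => v; rewrite vE.
apply/(all_nthP (c, c))/forallP => [h j|h j].
  by rewrite /p /q; exact: h.
by rewrite sz => jd; exact: (h (Ordinal jd)).
Qed.

Definition contr_or_spheres E := contractible R (realization R (edge_complex E)) \/
  exists (k : nat) (d : 'I_k.+1 -> nat),
    homotopy_equivalent R (realization R (edge_complex E)) (wedge_of_spheres R d).

Lemma heq_contr_or_spheres E E' : heq R E E' -> contr_or_spheres E' -> contr_or_spheres E.
Proof.
move=> EE' [cE'|[k [d hd]]]; first by left; exact: homotopy_equivalent_contractible cE'.
by right; exists k, d; exact: homotopy_equivalent_trans hd.
Qed.

Lemma mem_count w s : (w \in s) = (0 < count_mem w s)%N.
Proof. by rewrite -has_pred1 has_count. Qed.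

Lemma uniq_count s : (forall v, (count_mem v s <= 1)%N) -> uniq s.
Proof.
move=> h; apply: count_mem_uniq => x; have := h x.
by rewrite mem_count; case: (count_mem x s) => [|[]].
Qed.

Lemma all_loops L (A : {set V}) :
  all (fun e => ~~ ((e.1 \in A) && (e.2 \in A))) (loops L) =
  all (fun x => x \notin A) L.
Proof. by rewrite all_map; apply: eq_all => x /=; rewrite andbb. Qed.

(** Disjoint edges on the vertices that are not deleted: the complex is a join of two-point sets,
    hence a single sphere. Any end may serve as base point; the first one is taken. *)
Lemma contr_or_spheres_pairs ps L : ps != [::] ->
  (forall v, count_mem v (ends ps ++ L) = 1)%N -> contr_or_spheres (ps ++ loops L).
Proof.
case: ps => // e ps _ inv; right; exists 0%N.
apply: (@wedge_of_pair_lists _ 0 (fun=> e :: ps) e.1) => //.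
- move=> _; apply: uniq_count => v.
  by have := inv v; rewrite count_cat; lia.
- by move=> i i'; rewrite !ord1.
move=> A; rewrite in_edge_complex all_cat all_loops andbC.
apply/andP/existsP => [[/allP hL hp]|[_ /andP[/fintype.subsetP hs hp]]].
  exists ord0; apply/andP; split=> //; apply/fintype.subsetP => v vA.
  have vL : v \notin L by apply/negP => /hL; rewrite vA.
  by have := inv v; move: vL; rewrite !mem_count count_cat; lia.
split=> //; apply/allP => x xL; apply/negP => /hs xA.
have xe : x \in ends (e :: ps) by [].
by have := inv x; move: xL xe; rewrite !mem_count count_cat; lia.
Qed.

(** Locked so that simplification does not expand it on explicit lists; membership goes through
    [mem_cross]. *)
Definition cross X Y : seq (V * V) := locked [seq (x, y) | x <- X, y <- Y].

Lemma mem_cross X Y x y : ((x, y) \in cross X Y) = (x \in X) && (y \in Y).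
Proof.
rewrite /cross -lock.
apply/allpairsP/andP => [[[x' y'] /= [x'X y'Y [-> ->]]]//|[xX yY]].
by exists (x, y).
Qed.

Lemma ends_cross X Y w : w \in ends (cross X Y) -> (w \in X) || (w \in Y).
Proof.
move=> /endsP[[x y]]; rewrite mem_cross => /andP[xX yY].
by case=> -> /=; rewrite ?xX ?yY ?orbT.
Qed.

Lemma ends_loops L w : (w \in ends (loops L)) = (w \in L).
Proof. by elim: L => //= x L IH; rewrite !inE IH orbA orbb. Qed.

(* Cross-polytopes with antipodal pairs (c, x0) :: qs and (c, y0) :: qs',
   sharing the vertex c only. *)
Definition two_crosses c x0 qs y0 qs' : seq (V * V) :=
  [:: (c, x0), (c, y0) &
      qs ++ qs' ++ cross (x0 :: ends qs) (y0 :: ends qs')].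

(** The edges of [cross] prevent an independent set from meeting both sides away from [c], so it is
    a face of one of the two cross-polytopes. *)
Lemma contr_or_spheres_two_crosses c x0 qs y0 qs' L :
  (forall v, count_mem v (c :: (x0 :: ends qs) ++ (y0 :: ends qs') ++ L) = 1)%N ->
  contr_or_spheres (two_crosses c x0 qs y0 qs' ++ loops L).
Proof.
move=> inv; right; exists 1%N.
pose P (i : 'I_2) := if val i == 0%N then (c, x0) :: qs else (c, y0) :: qs'.
apply: (@wedge_of_pair_lists _ 1 P c).
- move=> i; apply: uniq_count => v; have := inv v; rewrite /P.
  by case: ifP => _; rewrite /= !count_cat /= ?count_cat; lia.
- by move=> i; rewrite /P; case: ifP.
- have disj v : v \in ends ((c, x0) :: qs) -> v \in ends ((c, y0) :: qs') -> v = c.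
    rewrite !mem_count => h1 h2; apply/eqP; rewrite eq_sym.
    by have := inv v; move: h1 h2; rewrite /= !count_cat /= ?count_cat; lia.
  move=> i i' v ii'; rewrite /P.
  have : (val i == 0%N) != (val i' == 0%N).
    apply: contraNneq ii'; rewrite -val_eqE; case: i i' => [[|[|//]] ?] [[|[|//]] ?] //=.
  by case: ifP => _; case: ifP => // _ _ h1 h2; apply: disj.
move=> A; rewrite in_edge_complex /two_crosses.
have := mem_cross (x0 :: ends qs) (y0 :: ends qs'); move: (cross _ _) => cr mem_cr.
rewrite /= !all_cat all_loops.
have lA v : v \notin L -> (v \in ends ((c, x0) :: qs)) || (v \in ends ((c, y0) :: qs')).
  rewrite !mem_count; have := inv v; rewrite /= !count_cat /= ?count_cat; lia.
apply/idP/existsP => [|[i /andP[/fintype.subsetP hs hp]]].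
  move=> /and3P[cx cy /andP[/and3P[hq hq' /allP hc] /allP hL]].
  have AL v : v \in A -> v \notin L by move=> vA; apply/negP => /hL; rewrite vA.
  case: (boolP (A \subset ends ((c, x0) :: qs))) => [Aq|].
    by exists ord0; rewrite Aq /= cx.
  (* The vertex y lies off the first cross-polytope, so a vertex x off the second one would be
     joined to y by an edge of [cross]. *)
  move=> /subsetPn[y yA yq]; exists ord_max; rewrite /P /pair_free /= cy hq' /= andbT.
  apply/fintype.subsetP => x xA; apply/negPn/negP => xq'.
  have {}xq' : x \notin ends ((c, y0) :: qs') by [].
  have {}yq : y \notin ends ((c, x0) :: qs) by [].
  have xq : x \in x0 :: ends qs.
    have := lA x (AL x xA); rewrite (negbTE xq') orbF /= inE => /predU1P[xc|//].
    by move: xq'; rewrite xc /= inE eqxx.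
  have yq' : y \in y0 :: ends qs'.
    have := lA y (AL y yA); rewrite (negbTE yq) /= inE => /predU1P[yc|//].
    by move: yq; rewrite yc /= inE eqxx.
  by have := hc (x, y); rewrite mem_cr xq yq' /= xA yA => /(_ isT).
have hL : all (fun x => x \notin A) L.
  apply/allP => x xL; apply/negP => /hs xP.
  have : x \in c :: (x0 :: ends qs) ++ (y0 :: ends qs').
    move: xP; rewrite /P !inE mem_cat !inE; case: ifP => _ /=; rewrite !inE;
    by do ![case/orP => [->|]; rewrite ?orbT //]; move=> ->; rewrite ?orbT.
  by have := inv x; move: xL; rewrite !mem_count /= !count_cat /= ?count_cat; lia.
have out s : {in s, forall x, x \notin A} -> forall qq, {subset ends qq <= s} ->
    all (fun e => ~~ ((e.1 \in A) && (e.2 \in A))) qq.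
  move=> sA qq qs_s; apply/allP => e /in_ends /andP[/qs_s/sA/negbTE -> _] //.
move: hs hp; rewrite hL andbT /P /pair_free; case: ifP => _ hs /= /andP[h1 h2].
  have yA : {in y0 :: ends qs', forall y, y \notin A}.
    move=> y yq; apply/negP => /hs yA.
    have {}yA : y \in ends ((c, x0) :: qs) by [].
    by have := inv y; move: yq yA; rewrite !mem_count /= !count_cat /= ?count_cat; lia.
  rewrite h1 h2 (negbTE (yA y0 _)) ?inE ?eqxx // andbF /=; apply/andP; split.
    by apply: (out (y0 :: ends qs')) => // y yq; rewrite inE yq orbT.
  by apply/allP => -[x y]; rewrite mem_cr => /andP[_ /yA/negbTE /= ->]; rewrite andbF.
have xA : {in x0 :: ends qs, forall y, y \notin A}.
  move=> y yq; apply/negP => /hs yA.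
  have {}yA : y \in ends ((c, y0) :: qs') by [].
  by have := inv y; move: yq yA; rewrite !mem_count /= !count_cat /= ?count_cat; lia.
rewrite h1 h2 (negbTE (xA x0 _)) ?inE ?eqxx // andbF /=; apply/andP; split.
  by apply: (out (x0 :: ends qs)) => // y yq; rewrite inE yq orbT.
by apply/allP => -[x y]; rewrite mem_cr => /andP[/xA/negbTE /= ->].
Qed.

End Outcomes.

(** * Suspensions of a wedge *)

Section Stars.
Variable V : finType.
Implicit Types (w x z p q : V) (N X : seq V).

Definition star w X : seq (V * V) := [seq (w, x) | x <- X].

Lemma mem_star w X p q : ((p, q) \in star w X) = (p == w) && (q \in X).
Proof.
apply/mapP/andP => [[x xX [-> ->]]|[/eqP-> qX]]; last by exists q.
by rewrite eqxx xX.
Qed.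

Lemma nbrs_in_star w N X : w \notin X -> {subset X <= N} -> nbrs_in w N (star w X).
Proof.
move=> wX XN; apply/allP => -[p q]; rewrite mem_star => /andP[_ qX] /=.
by rewrite (XN _ qX) implybT /=; apply/implyP => /eqP qw; rewrite -qw qX in wX.
Qed.

Lemma nbrs_in_star_out w N z X : (z == w) = false -> w \notin X ->
  nbrs_in w N (star z X).
Proof.
move=> zw wX; apply/allP => -[p q]; rewrite mem_star => /andP[/eqP-> qX] /=.
by rewrite zw /=; apply/implyP => /eqP qw; rewrite -qw qX in wX.
Qed.

Lemma ends_star w X x : (x \in ends (star w X)) -> (x == w) || (x \in X).
Proof.
move=> /endsP[[p q]]; rewrite mem_star => /andP[/eqP-> qX] [] -> /=.
  by rewrite eqxx.
by rewrite qX orbT.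
Qed.

End Stars.

Ltac edge_cases :=
  repeat match goal with
  | |- is_true (_ || _) -> _ => case/orP
  | |- is_true (_ && _) -> _ => case/andP
  | |- is_true (_ == _) -> _ => move=> /eqP ->
  | |- is_true false -> _ => done
  | |- is_true _ -> _ => move=> ?
  end.

Ltac edge_mem :=
  rewrite /= !(in_cons, mem_cat, mem_star, mem_cross, xpair_eqE) ?eqxx;
  repeat match goal with H : is_true (_ \in _) |- _ => rewrite ?H; clear H end;
  by rewrite ?orbT.

(** Identifies complexes of edge lists that differ in order, repetition, orientation or edges at
    looped vertices. *)
Ltac implied_edges :=
  apply: heq_implied; apply/allP => -[p q];
  rewrite /= !(in_cons, in_nil, mem_cat, mem_star, mem_cross, xpair_eqE);
  edge_cases;
  first [ apply: implied_mem; edge_mem | apply: implied_swap; edge_mem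
        | apply: implied_loopl; edge_mem | apply: implied_loopr; edge_mem].

Section Splitting.
Variables (R : realType) (V : finType).
Implicit Types (E D ps : seq (V * V)) (u v w x y z : V) (N s t L X Y : seq V).

(* Suspending a wedge: the pair (u, v) is duplicated into (y, z), so that one
   copy suspends the X-side and the other one the Y-side of the wedge at c. *)
Lemma heq_split_pair c x0 y0 X Y u v y z E :
  x0 \in X -> y0 \in Y -> uniq [:: c; u; v; y; z] ->
  (forall w, w \in [:: c; u; v; y; z] ->
     [&& w \notin X, w \notin Y & w \notin ends E]) ->
  (forall n b, n \in X -> b \in Y -> (n, b) \in E) ->
  heq R [:: (u, v), (y, y), (z, z), (c, x0), (c, y0) & E]
    [:: (u, y), (y, v), (y, z), (v, z), (z, u), (u, v), (c, x0), (c, y0) &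
        star u Y ++ star y X ++ star v Y ++ star z X ++ E].
Proof.
move=> x0X y0Y; rewrite /= !inE !negb_or.
move=> /and5P[/and4P[cu cv cy cz] /and3P[uv uy uz] /andP[vy vz] yz _] out XYE.
have sy (p q : V) : p != q -> (q == p) = false by rewrite eq_sym => /negbTE.
have mem5 w : w \in [:: c; u; v; y; z] -> [/\ w \notin X, w \notin Y & w \notin ends E].
  by move=> /out /and3P[].
have [cX cY cE] : [/\ c \notin X, c \notin Y & c \notin ends E].
  by apply: mem5; rewrite !inE eqxx.
have [uX uY uE] : [/\ u \notin X, u \notin Y & u \notin ends E].
  by apply: mem5; rewrite !inE eqxx ?orbT.
have [vX vY vE] : [/\ v \notin X, v \notin Y & v \notin ends E].
  by apply: mem5; rewrite !inE eqxx ?orbT.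
have [yX yY yE] : [/\ y \notin X, y \notin Y & y \notin ends E].
  by apply: mem5; rewrite !inE eqxx ?orbT.
have [zX zY zE] : [/\ z \notin X, z \notin Y & z \notin ends E].
  by apply: mem5; rewrite !inE eqxx ?orbT.
have nX w : w \notin X -> (x0 == w) = false by apply: contraNF => /eqP <-.
have nY w : w \notin Y -> (y0 == w) = false by apply: contraNF => /eqP <-.
have neqs := (negbTE cu, negbTE cv, negbTE cy, negbTE cz, negbTE uv, negbTE uy,
  negbTE uz, negbTE vy, negbTE vz, negbTE yz, sy _ _ cu, sy _ _ cv, sy _ _ cy,
  sy _ _ cz, sy _ _ uv, sy _ _ uy, sy _ _ uz, sy _ _ vy, sy _ _ vz, sy _ _ yz).
have neq0 := (nX _ cX, nX _ uX, nX _ vX, nX _ yX, nX _ zX,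
              nY _ cY, nY _ uY, nY _ vY, nY _ yY, nY _ zY).
have neq0' := (eq_sym u x0, eq_sym u y0, eq_sym c x0, eq_sym c y0, eq_sym v x0,
  eq_sym v y0, eq_sym y x0, eq_sym y y0, eq_sym z x0, eq_sym z y0).
pose F1 := [:: (z, u), (u, v), (c, x0), (c, y0) & star z X ++ E].
pose F3 := (v, z) :: star v Y ++ F1.
pose F4 := [:: (y, v), (y, z) & star y X ++ F3].
pose E1 := (y, y) :: F1.
(* Revive z with neighbours u and [X]: the only neighbour of v is u, so v justifies deleting z
   again. *)
apply: (@heq_trans R V E1).
  apply: (@heq_trans R V ((z, z) :: E1)).
    rewrite /E1 /F1; implied_edges.
  apply: heq_sym; apply: (@heq_add_edge R V E1 z z v [:: u]);
    rewrite ?neqs ?inE ?neqs //.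
  - rewrite /E1 /F1 /= !inE !eqxx !neqs !neq0 /=.
    by rewrite -/(nbrs_in _ _ _) nbrs_in_cat nbrs_in_star_out ?neqs // nbrs_in_out.
  - by rewrite /= /linked /E1 /F1 !inE !eqxx !orbT.
(* Join v to [Y] by means of z: its neighbour u is adjacent to v, and those in [X] are adjacent to
   all of [Y]. *)
apply: (@heq_trans R V (star v Y ++ E1)).
  apply: (@heq_add_edges R V _ E1 z (u :: X)).
  - by apply/negP => /ends_star; rewrite neqs (negbTE zY).
  - by rewrite inE neqs.
  - rewrite /E1 /F1 /= !inE !eqxx !neqs !neq0 /=.
    rewrite -/(nbrs_in _ _ _) nbrs_in_cat nbrs_in_star ?nbrs_in_out //.
    by move=> n nX'; rewrite inE nX' orbT.
  - apply/allP => -[p b]; rewrite mem_star => /andP[/eqP-> bY] /=.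
    rewrite /linked /E1 /F1 !inE !eqxx !orbT /=; apply/allP => n nX'.
    by rewrite !inE !mem_cat (XYE _ _ nX' bY) !orbT.
(* Join v to z by means of c: its neighbours are x0, adjacent to z, and y0, adjacent to v. *)
apply: (@heq_trans R V ((v, z) :: star v Y ++ E1)).
  apply: (@heq_add_edge R V _ v z c [:: x0; y0]); rewrite ?cv ?cz //.
  - by rewrite !inE !neq0' !neq0.
  - rewrite nbrs_in_cat nbrs_in_star_out ?neqs // /E1 /F1 /= !inE !eqxx !neqs !neq0 ?orbT /=.
    by rewrite -/(nbrs_in _ _ _) nbrs_in_cat nbrs_in_star_out ?neqs // nbrs_in_out.
  - rewrite /= /linked /E1 /F1 !mem_cat !inE !mem_cat !mem_star !eqxx x0X y0Y.
    by rewrite ?orbT.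
(* The same three moves with y and u for z and v: y is revived with neighbours v, z and [X], and
   N(u) = {v, z} justifies deleting it again. *)
apply: (@heq_trans R V F4).
  apply: (@heq_trans R V ((y, y) :: F4)).
    rewrite /F4 /F3 /E1 /F1; implied_edges.
  apply: heq_sym; apply: (@heq_add_edge R V F4 y y u [:: v; z]);
    rewrite ?inE ?neqs ?uy //.
  - rewrite /F4 /F3 /F1 /= !inE !eqxx !neqs /=.
    rewrite -/(nbrs_in _ _ _) nbrs_in_cat nbrs_in_star_out ?neqs //=.
    rewrite ?inE ?eqxx ?neqs /= -/(nbrs_in _ _ _) nbrs_in_cat nbrs_in_star_out ?neqs //=.
    rewrite ?inE ?eqxx ?neqs ?neq0 ?orbT /= -/(nbrs_in _ _ _) nbrs_in_cat.
    by rewrite nbrs_in_star_out ?neqs // nbrs_in_out.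
  - by rewrite /= /linked /F4 !inE !eqxx !orbT.
apply: (@heq_trans R V (star u Y ++ F4)).
  apply: (@heq_add_edges R V _ F4 y [:: v, z & X]).
  - by apply/negP => /ends_star; rewrite neqs (negbTE yY).
  - by rewrite !inE !neqs.
  - rewrite /F4 /F3 /F1 /= !inE !eqxx !neqs ?orbT /=.
    rewrite -/(nbrs_in _ _ _) nbrs_in_cat nbrs_in_star //=; last first.
      by move=> n nX'; rewrite !inE nX' !orbT.
    rewrite ?inE ?eqxx ?neqs /= -/(nbrs_in _ _ _) nbrs_in_cat nbrs_in_star_out ?neqs //=.
    rewrite ?inE ?eqxx ?neqs ?neq0 /= -/(nbrs_in _ _ _) nbrs_in_cat.
    by rewrite nbrs_in_star_out ?neqs // nbrs_in_out.
  - apply/allP => -[p b]; rewrite mem_star => /andP[/eqP-> bY] /=.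
    have hn n : n \in X -> linked F4 n b.
      move=> nX'; rewrite /linked /F4 /F3 /F1.
      by rewrite !(inE, mem_cat) (XYE _ _ nX' bY) !orbT.
    have [-> ->] : linked F4 v u /\ linked F4 z u.
      by rewrite /linked /F4 /F3 /F1 !(inE, mem_cat) !eqxx !orbT.
    by apply/allP => n /hn ->; rewrite orbT.
apply: (@heq_trans R V ((u, y) :: star u Y ++ F4)).
  apply: (@heq_add_edge R V _ u y c [:: x0; y0]); rewrite ?cu ?cy //.
  - by rewrite !inE !neq0' !neq0.
  - rewrite nbrs_in_cat nbrs_in_star_out ?neqs // /F4 /F3 /F1 /= ?inE ?eqxx ?neqs /=.
    rewrite -/(nbrs_in _ _ _) nbrs_in_cat nbrs_in_star_out ?neqs //=.
    rewrite ?inE ?eqxx ?neqs /= -/(nbrs_in _ _ _) nbrs_in_cat nbrs_in_star_out ?neqs //=.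
    rewrite ?inE ?eqxx ?neqs ?neq0 ?orbT /= -/(nbrs_in _ _ _) nbrs_in_cat.
    by rewrite nbrs_in_star_out ?neqs // nbrs_in_out.
  - rewrite /= /linked /F4 /F3 /F1 !mem_cat !inE !mem_cat !mem_star !eqxx x0X y0Y.
    by rewrite ?orbT.
rewrite /F4 /F3 /F1; implied_edges.
Qed.

End Splitting.

Section Suspension.
Variables (R : realType) (V : finType).
Implicit Types (E D ps : seq (V * V)) (u v w x y z a c : V) (N s t L X Y : seq V).

Lemma heq_two_crosses_split c x0 qs y0 qs' u v y z ps L :
  (forall w, count_mem w (c :: (x0 :: ends qs) ++ (y0 :: ends qs') ++
     ends ((u, v) :: ps) ++ y :: z :: L) = 1)%N ->
  heq R (two_crosses c x0 qs y0 qs' ++ ((u, v) :: ps) ++ loops (y :: z :: L))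
    (two_crosses c x0 ((u, v) :: qs) y0 ((y, z) :: qs') ++ ps ++ loops L).
Proof.
move=> inv; rewrite /two_crosses.
pose X := x0 :: ends qs; pose Y := y0 :: ends qs'.
pose E := qs ++ qs' ++ cross X Y ++ ps ++ loops L.
have sub w : w \in ends E -> [|| w \in X, w \in Y, w \in ends ps | w \in L].
  rewrite /E !ends_cat !mem_cat ends_loops.
  case/or4P=> [h|h|/ends_cross/orP[]h|/orP[]h]; rewrite ?h ?orbT //.
    by rewrite /X !inE h !orbT.
  by rewrite /Y !inE h !orbT.
apply: (@heq_trans R V [:: (u, v), (y, y), (z, z), (c, x0), (c, y0) & E]).
  rewrite /E /X /Y; implied_edges.
apply: (heq_trans (@heq_split_pair R V c x0 y0 X Y u v y z E _ _ _ _ _)).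
- by rewrite inE eqxx.
- by rewrite inE eqxx.
- apply: uniq_count => w; have := inv w; do 4 rewrite ?count_cat /=; lia.
- move=> w w5.
  have h : [&& w \notin X, w \notin Y, w \notin ends ps & w \notin L].
    move: w5; rewrite !mem_count; have := inv w.
    rewrite /X /Y; do 4 rewrite ?count_cat /=; lia.
  case/and4P: h => h1 h2 h3 h4; rewrite h1 h2 /=.
  by apply/negP => /sub; rewrite (negbTE h1) (negbTE h2) (negbTE h3) (negbTE h4).
- by move=> n b nX bY; rewrite /E !mem_cat mem_cross nX bY !orbT.
rewrite /E /X /Y; implied_edges.
Qed.

(** Each pair of [ps] suspends both cross-polytopes: one keeps the pair, the other receives two
    spare vertices from [L]. Hence the factor 2 in the bound. *)
Lemma contr_or_spheres_two_crosses_pairs c x0 qs y0 qs' ps L :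
  (forall w, count_mem w (c :: (x0 :: ends qs) ++ (y0 :: ends qs') ++
     ends ps ++ L) = 1)%N ->
  ((size ps).*2 <= size L)%N ->
  contr_or_spheres R (two_crosses c x0 qs y0 qs' ++ ps ++ loops L).
Proof.
elim: ps qs qs' L => [|[u v] ps IH] qs qs' L inv.
  by move=> _; exact: contr_or_spheres_two_crosses.
case: L inv => [|y [|z L]] inv //= szL.
apply: heq_contr_or_spheres (heq_two_crosses_split inv) _; apply: IH; last by move: szL; lia.
by move=> w; have := inv w; do 4 rewrite ?count_cat /=; lia.
Qed.

End Suspension.

(** * Two cycles sharing a vertex *)

Section Cycles.
Variables (R : realType) (V : finType).
Implicit Types (E D ps : seq (V * V)) (u v w x y z a c : V) (N s t L X Y : seq V).

Fixpoint path_edges x s : seq (V * V) :=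
  if s is y :: s' then (x, y) :: path_edges y s' else [::].

(** A single inner vertex gives the cycle of length 2, that is, one edge listed in both
    orientations. *)
Definition cycle_edges a s := path_edges a (rcons s a).

Lemma ends_path_edges x s w : w \in ends (path_edges x s) -> w \in x :: s.
Proof.
elim: s x => //= y s IH x; rewrite !inE => /or3P[->|->|/IH]; rewrite ?orbT //.
by rewrite inE => ->; rewrite orbT.
Qed.

Definition two_cycles a s t ps L :=
  cycle_edges a s ++ cycle_edges a t ++ ps ++ loops L.

(** An exact count encodes disjointness and covering of [V] at once, and regrouping the lists
    becomes linear arithmetic. *)
Definition partitions a s t ps L :=
  forall w, (count_mem w (a :: s ++ t ++ ends ps ++ L) = 1)%N.

Lemma heq_two_cyclesC a s t ps L :
  heq R (two_cycles a s t ps L) (two_cycles a t s ps L).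
Proof.
rewrite /heq (@eq_edge_complex _ _ (two_cycles a t s ps L)); first exact: heq_refl.
by move=> e; rewrite !mem_cat orbCA.
Qed.

(** The far end b of the path must differ from a, so at least four inner vertices are required and
    cycles of length 2, 3 and 4 remain. *)
Lemma heq_shorten_cycle a x y z b s t ps L :
  partitions a [:: x, y, z, b & s] t ps L ->
  heq R (two_cycles a [:: x, y, z, b & s] t ps L)
        (two_cycles a (b :: s) t ((y, z) :: ps) (x :: L)).
Proof.
move=> inv; pose E := path_edges b (rcons s a) ++ cycle_edges a t ++ ps ++ loops L.
have out w : w \in [:: x; y; z] -> w \notin ends E.
  move=> w3; have : w \notin [:: a, b & s] ++ t ++ ends ps ++ L.
    by move: w3; rewrite !mem_count; have := inv w; do 4 rewrite ?count_cat /=; lia.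
  apply: contraNN; rewrite /E !ends_cat !mem_cat ends_loops.
  case/or4P => [/ends_path_edges|/ends_path_edges|->|->]; rewrite ?orbT //.
    by rewrite !(inE, mem_rcons) => /or3P[]->; rewrite ?orbT.
  by rewrite !(inE, mem_rcons) => /or3P[]->; rewrite ?orbT.
apply: (heq_trans (@heq_subdivided_edge R V E a x y z b _ _ _ _)).
- by apply: uniq_count => w; have := inv w; do 4 rewrite ?count_cat /=; lia.
- by apply: out; rewrite !inE eqxx.
- by apply: out; rewrite !inE eqxx ?orbT.
- by apply: out; rewrite !inE eqxx ?orbT.
rewrite /E /two_cycles; move: (cycle_edges a t) => C.
rewrite /cycle_edges /=; move: (path_edges _ _) => P.
implied_edges.
Qed.

Ltac split_ands :=
  repeat match goal with
  | H : is_true (_ && _) |- _ => case/andP: H => ? ?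
  end.

Ltac neq_simpl :=
  repeat match goal with
  | H : is_true (?p != ?q) |- context [?p == ?q] => rewrite (negbTE H)
  | H : is_true (?p != ?q) |- context [?q == ?p] =>
      rewrite (eq_sym q p) (negbTE H)
  end.

Definition isolated_from E s := all (fun w => w \notin ends E) s.

Lemma partitions_neq a s t ps L : partitions a s t ps L ->
  uniq (a :: s ++ t) && isolated_from (ps ++ loops L) (a :: s ++ t).
Proof.
move=> inv; apply/andP; split.
  by apply: uniq_count => w; have := inv w; do 4 rewrite ?count_cat /=; lia.
apply/allP => w; rewrite ends_cat mem_cat ends_loops !mem_count.
by have := inv w; do 4 rewrite ?count_cat /=; lia.
Qed.

Ltac nbrs := rewrite /two_cycles /cycle_edges /= ?inE ?eqxx; neq_simpl;
  rewrite ?orbT /=; apply: nbrs_in_out; assumption.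
Ltac links := rewrite /= /linked /two_cycles /cycle_edges /= !inE !eqxx ?orbT //=.
Ltac distinct := rewrite ?inE; neq_simpl; done.
(** Both x and y are leaves at a, so y is deleted thanks to x and a single edge is left beside
    [ps]. *)
Lemma contr_or_spheres_cycles_1_1 a x y ps L :
  partitions a [:: x] [:: y] ps L -> contr_or_spheres R (two_cycles a [:: x] [:: y] ps L).
Proof.
move=> inv.
apply: (@heq_contr_or_spheres _ _ _ (((a, x) :: ps) ++ loops (y :: L))); last first.
  by apply: contr_or_spheres_pairs => // w; have := inv w; do 4 rewrite ?count_cat /=; lia.
have := partitions_neq inv; rewrite /= !inE !negb_or => h; split_ands.
apply: (heq_trans (@heq_add_edge R V _ y y x [:: a] _ _ _ _ _)).
- distinct.
- distinct.
- distinct.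
- nbrs.
- links.
rewrite /two_cycles /cycle_edges; implied_edges.
Qed.

(** N(x) = {a}, so the leaf x permits deleting the other neighbours y1, y2 of a. *)
Lemma contr_or_spheres_cycles_1_2 a x y1 y2 ps L : partitions a [:: x] [:: y1; y2] ps L ->
  contr_or_spheres R (two_cycles a [:: x] [:: y1; y2] ps L).
Proof.
move=> inv.
apply: (@heq_contr_or_spheres _ _ _ (((a, x) :: ps) ++ loops (y1 :: y2 :: L))); last first.
  by apply: contr_or_spheres_pairs => // w; have := inv w; do 4 rewrite ?count_cat /=; lia.
have := partitions_neq inv; rewrite /= !inE !negb_or => h; split_ands.
apply: (heq_trans (@heq_add_edges R V [:: (y1, y1); (y2, y2)] _ x [:: a] _ _ _ _)).
- distinct.
- distinct.
- nbrs.
- links.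
rewrite /two_cycles /cycle_edges; implied_edges.
Qed.

(** The leaf x permits deleting y1 and y3, which isolates y2. *)
Lemma contr_or_spheres_cycles_1_3 a x y1 y2 y3 ps L : partitions a [:: x] [:: y1; y2; y3] ps L ->
  contr_or_spheres R (two_cycles a [:: x] [:: y1; y2; y3] ps L).
Proof.
move=> inv; have := partitions_neq inv; rewrite /= !inE !negb_or => h; split_ands.
apply: (heq_contr_or_spheres (@heq_add_edges R V [:: (y1, y1); (y3, y3)] _ x [:: a] _ _ _ _)).
- distinct.
- distinct.
- nbrs.
- links.
left; apply: (@edge_complex_contractible R V _ y2 [:: y1; y3]).
- distinct.
- nbrs.
- links.
Qed.

(** Opposite vertices of the 4-cycle: N(x2) = {x1, x3} lies in N(a), so a is deleted; then N(x1) =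
    {a, x2} lies in N(x3), so x3 is deleted. *)
Lemma heq_cycle_3 a x1 x2 x3 t ps L : partitions a [:: x1; x2; x3] t ps L ->
  heq R (two_cycles a [:: x1; x2; x3] t ps L)
    ([:: (a, a); (x1, x2); (x3, x3)] ++ cycle_edges a t ++ ps ++ loops L).
Proof.
move=> inv; pose F := cycle_edges a t ++ ps ++ loops L.
have out w : w \in [:: x1; x2; x3] -> w \notin ends F.
  move=> w3; have : w \notin a :: t ++ ends ps ++ L.
    by move: w3; rewrite !mem_count; have := inv w; do 4 rewrite ?count_cat /=; lia.
  apply: contraNN; rewrite /F !ends_cat !inE !mem_cat ends_loops.
  case/or3P => [/ends_path_edges|->|->]; rewrite ?orbT //.
  by rewrite !(inE, mem_rcons) => /or3P[]->; rewrite ?orbT.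
have o1 : x1 \notin ends F by apply: out; rewrite !inE eqxx.
have o2 : x2 \notin ends F by apply: out; rewrite !inE eqxx orbT.
have := partitions_neq inv; rewrite /= !inE !negb_or => h; split_ands.
rewrite /two_cycles -/F.
apply: (heq_trans (@heq_add_edge R V _ a a x2 [:: x1; x3] _ _ _ _ _)).
- distinct.
- distinct.
- distinct.
- nbrs.
- links.
apply: (heq_trans (@heq_add_edge R V _ x3 x3 x1 [:: a; x2] _ _ _ _ _)).
- distinct.
- distinct.
- distinct.
- nbrs.
- links.
clear out o1 o2; move: F => F; rewrite /cycle_edges; implied_edges.
Qed.

Lemma contr_or_spheres_cycles_3_2 a x1 x2 x3 y1 y2 ps L :
  partitions a [:: x1; x2; x3] [:: y1; y2] ps L ->
  contr_or_spheres R (two_cycles a [:: x1; x2; x3] [:: y1; y2] ps L).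
Proof.
move=> inv; apply: heq_contr_or_spheres (heq_cycle_3 inv) _.
apply: (@heq_contr_or_spheres _ _ _ ([:: (x1, x2), (y1, y2) & ps] ++ loops (a :: x3 :: L))).
  rewrite /cycle_edges; implied_edges.
by apply: contr_or_spheres_pairs => // w; have := inv w; do 4 rewrite ?count_cat /=; lia.
Qed.

(** Without a, the second cycle is the path y1 y2 y3, whose end y3 is deleted thanks to y1. *)
Lemma contr_or_spheres_cycles_3_3 a x1 x2 x3 y1 y2 y3 ps L :
  partitions a [:: x1; x2; x3] [:: y1; y2; y3] ps L ->
  contr_or_spheres R (two_cycles a [:: x1; x2; x3] [:: y1; y2; y3] ps L).
Proof.
move=> inv; apply: heq_contr_or_spheres (heq_cycle_3 inv) _.
have G : contr_or_spheres R ([:: (x1, x2), (y1, y2) & ps] ++ loops (a :: x3 :: y3 :: L)).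
  by apply: contr_or_spheres_pairs => // w; have := inv w; do 4 rewrite ?count_cat /=; lia.
have := partitions_neq inv; rewrite /= !inE !negb_or => h; split_ands.
apply: (heq_contr_or_spheres (@heq_add_edge R V _ y3 y3 y1 [:: a; y2] _ _ _ _ _)).
- distinct.
- distinct.
- distinct.
- nbrs.
- links.
apply: heq_contr_or_spheres G.
rewrite /cycle_edges; implied_edges.
Qed.

(* I(C_3 v C_3) is the disjoint union of a 4-cycle and a point: the wedge at x1
   of the cross-polytopes on {x1, x2}, {y1, y2} and on {x1, a}. *)
Lemma contr_or_spheres_cycles_2_2 a x1 x2 y1 y2 ps L :
  partitions a [:: x1; x2] [:: y1; y2] ps L -> ((size ps).*2 <= size L)%N ->
  contr_or_spheres R (two_cycles a [:: x1; x2] [:: y1; y2] ps L).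
Proof.
move=> inv szL.
apply: (@heq_contr_or_spheres _ _ _ (two_crosses x1 x2 [:: (y1, y2)] a [::] ++ ps ++ loops L));
  last first.
  apply: contr_or_spheres_two_crosses_pairs => // w.
  by have := inv w; do 4 rewrite ?count_cat /=; lia.
rewrite /two_crosses /two_cycles /cycle_edges; implied_edges.
Qed.

(** The bound reserves two spares per pair and one per inner vertex. A shortening removes three
    inner vertices and adds one pair and one spare, so the bound persists and covers all pairs when
    two triangles are reached. *)
Lemma contr_or_spheres_two_cycles a s t ps L :
  partitions a s t ps L -> ((size ps).*2 + size s + size t <= size L)%N ->
  (0 < size s)%N -> (0 < size t)%N -> contr_or_spheres R (two_cycles a s t ps L).
Proof.
have [n] := ubnP (size s + size t)%N.
have partC a' s' t' ps' L' : partitions a' s' t' ps' L' -> partitions a' t' s' ps' L'.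
  by move=> inv w; have := inv w; do 4 rewrite ?count_cat /=; lia.
have swap a' s' t' ps' L' : contr_or_spheres R (two_cycles a' s' t' ps' L') ->
    contr_or_spheres R (two_cycles a' t' s' ps' L').
  by apply: heq_contr_or_spheres; exact: heq_two_cyclesC.
elim: n => // n IH in s t ps L *.
wlog st : s t / (size s <= size t)%N.
  move=> W szn inv szL s0 t0; have [st|/ltnW ts] := leqP (size s) (size t).
    exact: W.
  by apply: swap; apply: W => //; [rewrite addnC|exact: partC|move: szL; lia].
case: t st => [|y1 [|y2 [|y3 [|y4 t]]]] // st szn inv szL s0 _; last first.
  apply: swap; apply: heq_contr_or_spheres (heq_shorten_cycle (partC _ _ _ _ _ inv)) _.
  apply: IH => //.
  - by move: szn => /=; lia.
  - by move=> w; have := inv w; do 4 rewrite ?count_cat /=; lia.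
  - by move: szL => /=; lia.
all: case: s st s0 szn inv szL => [|x1 [|x2 [|x3 [|x4 s]]]] // _ _ _ inv szL.
- exact: contr_or_spheres_cycles_1_3.
- by apply: swap; apply: contr_or_spheres_cycles_3_2; exact: partC.
- exact: contr_or_spheres_cycles_3_3.
- exact: contr_or_spheres_cycles_1_2.
- by apply: contr_or_spheres_cycles_2_2 => //; move: szL => /=; lia.
- exact: contr_or_spheres_cycles_1_1.
Qed.

End Cycles.

(** * The wedge of two cycle graphs *)

Section Enlarge.
Local Open Scope ring_scope.
Variables (R : realType) (V U : finType).
Variables (K : {set {set V}}) (K' : {set {set (V + U)}}).
Hypothesis K'E : forall A : {set V + U}, (A \in K') =
  [forall u : U, inr u \notin A] && (finset (fun v => inl v \in A) \in K).

Definition extend0 (x : V -> R) (z : V + U) : R :=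
  if z is inl v then x v else 0.

Lemma extend0P x : realization_set R K x -> realization_set R K' (extend0 x).
Proof.
move=> [x0 x1 xK]; split; first by case.
  by rewrite big_sumType /= x1 big1 ?addr0.
rewrite K'E; apply/andP; split; first by apply/forallP => u; rewrite inE eqxx.
by move: xK; congr (_ \in K); apply/setP => v; rewrite !inE.
Qed.

Lemma restrict_extend0 y :
  realization_set R K' y -> y = extend0 (fun v => y (inl v)).
Proof.
move=> [_ _]; rewrite K'E => /andP[/forallP yU _]; apply/funext => -[v|u] //=.
by apply/eqP; have := yU u; rewrite inE negbK.
Qed.

Lemma restrictP y :
  realization_set R K' y -> realization_set R K (fun v => y (inl v)).
Proof.
move=> yK; have [y0 y1] := yK; rewrite K'E => /andP[_ yV]; split=> //.
  rewrite -y1 big_sumType /= [X in _ + X]big1 ?addr0 // => u _.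
  by rewrite (restrict_extend0 yK).
by move: yV; congr (_ \in K); apply/setP => v; rewrite !inE.
Qed.

(** Vertices of [U] lie in no simplex, so their coordinates vanish and extension by zero is a
    homeomorphism. *)
Lemma homotopy_equivalent_enlarge :
  homotopy_equivalent R (realization R K) (realization R K').
Proof.
pose f (x : realization R K) : realization R K' := rlz (extend0P (rlzP x)).
pose g (y : realization R K') : realization R K := rlz (restrictP (rlzP y)).
apply: (@homeomorphic_homotopy_equivalent R _ _ f g).
- apply: continuous_rlz => -[v|u] /=; first exact: rlz_coord_continuous.
  exact: cst_continuous.
- by apply: continuous_rlz => v /=; exact: rlz_coord_continuous.
- by move=> x; apply: val_inj.
- by move=> y; apply: val_inj; rewrite /= [RHS](restrict_extend0 (rlzP y)).
Qed.

End Enlarge.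

(** * The wedge of two cycle graphs as an edge list *)

Section InitialGraph.

Lemma path_edges_map (T T' : finType) (f : T -> T') x s :
  path_edges (f x) (map f s) = [seq (f e.1, f e.2) | e <- path_edges x s].
Proof. by elim: s x => //= y s IH x; rewrite IH. Qed.

Lemma path_edges_traject (T : finType) (f : T -> T) x n :
  path_edges x (traject f (f x) n) = [seq (y, f y) | y <- traject f x n].
Proof. by elim: n x => //= n IH x; rewrite IH. Qed.

Lemma iter_ordS n (i : 'I_n) k : val (iter k (@ordS n) i) = (i + k) %% n.
Proof.
elim: k => [|k IH] /=; first by rewrite addn0 modn_small.
by rewrite IH -addn1 modnDml addn1 addnS.
Qed.

Lemma iter_ordS_id n (i : 'I_n) : iter n (@ordS n) i = i.
Proof. by apply: val_inj; rewrite iter_ordS modnDr modn_small. Qed.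

Lemma mem_traject_ordS n (i j : 'I_n) : j \in traject (@ordS _) i n.
Proof.
have n0 : 0 < n by apply: leq_ltn_trans (ltn_ord i).
apply/trajectP; exists ((j + n - i) %% n); first by rewrite ltn_mod.
apply: val_inj; rewrite iter_ordS modnDmr subnKC; last first.
  by rewrite (leq_trans (ltnW (ltn_ord i))) // leq_addl.
by rewrite modnDr modn_small.
Qed.

Lemma cycle_edges_ordS n (a : 'I_n.+1) :
  cycle_edges a (traject (@ordS _) (ordS a) n) =
  [seq (x, ordS x) | x <- traject (@ordS _) a n.+1].
Proof.
rewrite /cycle_edges -path_edges_traject trajectSr; congr path_edges.
by rewrite -iterSr iter_ordS_id.
Qed.

Variables (m n : nat) (a1 : 'I_m.+1) (a2 : 'I_n.+1).
Let V : finType := graph_wedge_vertex 'I_m.+1 a2.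
Let e : rel V := graph_wedge_adj (cycle_adj m.+1) (cycle_adj n.+1) a1 a2.

Let f1 (x : 'I_m.+1) : V + V := inl (graph_wedge_proj a1 a2 (inl x)).
Let f2 (x : 'I_n.+1) : V + V := inl (graph_wedge_proj a1 a2 (inr x)).
(** The spares are a full copy of [V]: m + 1 + n vertices, enough for the m + n inner vertices of
    the two cycles. *)
Let L : seq (V + V) := [seq inr v | v <- enum V].
Let s := [seq f1 x | x <- traject (@ordS _) (ordS a1) m].
Let t := [seq f2 x | x <- traject (@ordS _) (ordS a2) n].

Lemma f2_base : f2 a2 = f1 a1.
Proof. by rewrite /f2 /= insubF // eqxx. Qed.

Lemma card_wedge_vertex : #|V| = (m.+1 + n)%N.
Proof.
rewrite card_sum card_ord card_sig; congr addn.
have -> : #|[pred v | v != a2]| = #|predC1 a2| by apply: eq_card.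
by rewrite cardC1 card_ord.
Qed.

Lemma size_spares : size L = #|V|.
Proof. by rewrite /L size_map cardE. Qed.

(** Every vertex occurs in the list, whose length is the number of vertices; so none occurs twice,
    and disjointness needs no separate check. *)
Lemma wedge_vertices_partition : partitions (f1 a1) s t [::] L.
Proof.
set l := f1 a1 :: s ++ t ++ ends [::] ++ L.
have mem w : w \in l.
  rewrite /l; case: w => [[x|v]|u].
  - have := mem_traject_ordS a1 x; rewrite /= inE => /predU1P[->|xs].
      by rewrite inE eqxx.
    by rewrite in_cons mem_cat (map_f f1 xs) !orbT.
  - have := mem_traject_ordS a2 (val v); rewrite /= inE => /predU1P[va|vt].
      by case: v va => v h va; have := h; rewrite [v in v != _]va eqxx.
    have -> : inl (inr v) = f2 (val v) by rewrite /f2 /= valK.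
    by rewrite in_cons !mem_cat (map_f f2 vt) !orbT.
  - by rewrite in_cons !mem_cat /= map_f ?mem_enum // !orbT.
have ul : uniq l.
  apply: (leq_size_uniq (enum_uniq {: V + V})) => [w _|]; first exact: mem.
  rewrite -cardE card_sum /l /= !size_cat size_spares !size_map !size_traject.
  rewrite card_wedge_vertex; lia.
by move=> w; rewrite count_uniq_mem ?mem.
Qed.

Lemma wedge_complex_enlarge (A : {set V + V}) :
  (A \in edge_complex (two_cycles (f1 a1) s t [::] L)) =
  [forall u : V, inr u \notin A] &&
  (finset (fun v : V => inl v \in A) \in independence_complex e).
Proof.
have E1 : cycle_edges (f1 a1) s = [seq (f1 x, f1 (ordS x)) | x <- traject (@ordS _) a1 m.+1].
  rewrite /cycle_edges /s -map_rcons path_edges_map.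
  by rewrite -/(cycle_edges _ _) cycle_edges_ordS -map_comp.
have E2 : cycle_edges (f1 a1) t = [seq (f2 x, f2 (ordS x)) | x <- traject (@ordS _) a2 n.+1].
  rewrite -f2_base /cycle_edges /t -map_rcons path_edges_map.
  by rewrite -/(cycle_edges _ _) cycle_edges_ordS -map_comp.
rewrite in_edge_complex /two_cycles E1 E2 !all_cat all_loops.
apply/and4P/andP => [[h1 h2 _ h3]|[/forallP h3]].
  split; first by apply/forallP => u; apply: (allP h3); rewrite map_f ?mem_enum.
  rewrite inE; apply/forall_inP => p; rewrite inE => pA.
  apply/forall_inP => q; rewrite inE => qA; apply/negP.
  have k1 x : ~~ ((f1 x \in A) && (f1 (ordS x) \in A)).
    apply: (allP h1 (f1 x, f1 (ordS x))).
    by apply/mapP; exists x => //; exact: mem_traject_ordS.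
  have k2 x : ~~ ((f2 x \in A) && (f2 (ordS x) \in A)).
    apply: (allP h2 (f2 x, f2 (ordS x))).
    by apply/mapP; exists x => //; exact: mem_traject_ordS.
  (* An edge of the wedge lifts to an edge of one of the two cycles, in one of two orientations:
     four cases. *)
  case/existsP => x /existsP[y /and3P[/eqP xp /eqP yq]].
  case: x xp => [x|x] xp; case: y yq => [y|y] yq //= /orP[]/eqP xy.
  - by have := k1 x; rewrite -xy /f1 xp yq pA qA.
  - by have := k1 y; rewrite -xy /f1 xp yq pA qA.
  - by have := k2 x; rewrite -xy /f2 xp yq pA qA.
  - by have := k2 y; rewrite -xy /f2 xp yq pA qA.
rewrite inE => /forall_inP h.
have k p q : e p q -> ~~ ((inl p \in A) && (inl q \in A)).
  move=> epq; apply/negP => /andP[pA qA].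
  by have := h p; rewrite inE => /(_ pA)/forall_inP/(_ q); rewrite inE qA epq => /(_ isT).
split=> //.
- apply/allP => _ /mapP[x _ ->] /=; apply: k; apply/existsP; exists (inl x).
  by apply/existsP; exists (inl (ordS x)); rewrite !eqxx; exact/orP/or_introl/eqP.
- apply/allP => _ /mapP[x _ ->] /=; apply: k; apply/existsP; exists (inr x).
  by apply/existsP; exists (inr (ordS x)); rewrite !eqxx; exact/orP/or_introl/eqP.
- by apply/allP => _ /mapP[x _ ->].
Qed.

Lemma contr_or_spheres_cycle_wedge (R : realType) : 0 < m -> 0 < n ->
  contr_or_spheres R (two_cycles (f1 a1) s t [::] L).
Proof.
move=> m0 n0; apply: contr_or_spheres_two_cycles; first exact: wedge_vertices_partition.
- by rewrite size_spares card_wedge_vertex !size_map !size_traject /=; lia.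
- by rewrite size_map size_traject.
- by rewrite size_map size_traject.
Qed.

End InitialGraph.

Theorem theorem3p5 (R : realType) (m n : nat) (hm : (3 <= m)%N) (hn : (3 <= n)%N)
    (a1 : 'I_m) (a2 : 'I_n) :
  let X := realization R (independence_complex
             (graph_wedge_adj (cycle_adj m) (cycle_adj n) a1 a2)) in
  contractible R X \/
  exists (k : nat) (d : 'I_k.+1 -> nat),
    homotopy_equivalent R X (wedge_of_spheres R d).
Proof.
case: m n hm hn a1 a2 => [|m] // [|n] // hm hn a1 a2 X.
have h := homotopy_equivalent_enlarge R (@wedge_complex_enlarge m n a1 a2).
have [hc|[k [d hd]]] := @contr_or_spheres_cycle_wedge m n a1 a2 R (ltnW hm) (ltnW hn).
  by left; exact: homotopy_equivalent_contractible h hc.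
by right; exists k, d; exact: homotopy_equivalent_trans h hd.
Qed.
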